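(* Let $0<s\le 1$ and suppose that there are constants $c>0$ and $Q>0$ such that $$\frac{\mu(B(y,r))}{\mu(B(x,R))}\ge c\Big(\frac rR\Big)^Q\quad\text{for every } x\in\mathcal P,\ 0<r\le R,\ y\in B(x,R).$$ Denote $q=Q/(Q+s)$. Let $X$ be a quasi-Banach function space over $\mathcal P$ with absolutely continuous quasinorm, and suppose that for every ball $B\subset\mathcal P$ there exists a constant $C$ such that $$\|(\mathcal M_1 g^q)^{1/q}\chi_B\|_X\le C\|g\|_X\quad\text{for every } 0\le g\in X.$$ Then, for every quasicontinuous $u\in\dot M^{s,X}(\mathcal P)$, quasievery point is a Lebesgue point of $u$.
   Context: Space. $\mathcal P=(\mathcal P,d,\mu)$ is a metric space $(\mathcal P,d)$ with a Borel regular outer measure $\mu$ such that every ball $B(x,r)=\{y\in\mathcal P: d(y,x)<r\}$ ($r>0$) has positive and finite measure, and $\mu$ is doubling: there is a constant $c_d>0$ with $\mu(B(x,2r))\le c_d\,\mu(B(x,r))$ for all $x\in\mathcal P$, $r>0$. $L^0=L^0(\mathcal P)$ is the set of measurable, almost everywhere finite functions $u:\mathcal P\to[-\infty,\infty]$. $\chi_E$ is the characteristic function of $E$. Quasi-Banach function spaces. A quasinorm on a subspace of $L^0$ is a functional $\|\cdot\|$ with: $\|f\|=0$ iff $f=0$ a.e.; $\|\alpha f\|=|\alpha|\|f\|$ for $\alpha\in\mathbb R$; $\|f+g\|\le c_\Delta(\|f\|+\|g\|)$ for some constant $c_\Delta$. A quasi-Banach function space $X$ over $\mathcal P$ is a subspace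 of $L^0(\mathcal P)$ with a complete quasinorm $\|\cdot\|_X$ such that: if $g\in X$ and $|f|\le|g|$ a.e. then $f\in X$ and $\|f\|_X\le\|g\|_X$; if $\mu(E)<\infty$ then $\|\chi_E\|_X<\infty$; if $0\le f_k\uparrow f$ a.e. then $\|f_k\|_X\uparrow\|f\|_X$ (with $\|f\|_X=\infty$ for $f\notin X$). The quasinorm is absolutely continuous if $\|f\chi_{E_k}\|_X\to0$ whenever $f\in X$ and $(E_k)$ is a decreasing sequence of sets with $\bigcap_k E_k=\emptyset$. Hajłasz spaces. A measurable $g:\mathcal P\to[0,\infty]$ is an $s$-gradient of $u\in L^0$ if there is $E\subset\mathcal P$ with $\mu(E)=0$ such that $|u(x)-u(y)|\le d(x,y)^s(g(x)+g(y))$ for all $x,y\in\mathcal P\setminus E$. $\mathcal D^s(u)$ is the set of all $s$-gradients of $u$. $\dot M^{s,X}$ consists of measurable $u$ with $\|u\|_{\dot M^{s,X}}=\inf_{g\in\mathcal D^s(u)}\|g\|_X<\infty$; $M^{s,X}=\dot M^{s,X}\cap X$ with $\|u\|_{M^{s,X}}=\|u\|_X+\|u\|_{\dot M^{s,X}}$. Capacity. $C_{M^{s,X}}(E)=\inf\{\|u\|_{M^{s,X}}: u\in M^{s,X},\ u\ge1 \text{ on a neighbourhood of } E\}$. A property holds for quasievery point (quasieverywhere) if it holds outside a set of $M^{s,X}$-capacity zero. A function $u:\mathcal P\to[-\infty,\infty]$ is quasicontinuous if for every $\varepsilon>0$ there is $E\subset\mathcal P$ with $C_{M^{s,X}}(E)<\varepsilon$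 such that the restriction of $u$ to $\mathcal P\setminus E$ is continuous. Maximal function and Lebesgue points. $\mathcal M_R u(x)=\sup_{0<r<R}\frac1{\mu(B(x,r))}\int_{B(x,r)}|u|\,d\mu$. A point $x$ is a Lebesgue point of $u$ if $\lim_{r\to0}\frac1{\mu(B(x,r))}\int_{B(x,r)}u\,d\mu=u(x)$. *)

(* Defs.v *)
From HB Require Import structures.
From mathcomp Require Import all_boot all_order all_algebra.
From mathcomp Require Import all_classical all_reals all_analysis.
From mathcomp Require Import measurable_realfun.

Set Implicit Arguments.
Unset Strict Implicit.
Unset Printing Implicit Defensive.
Import Order.TTheory GRing.Theory Num.Theory.
Import numFieldNormedType.Exports.

Local Open Scope classical_set_scope.
Local Open Scope ring_scope.
Local Open Scope ereal_scope.

(* The base point is needed by the library to equip [caratheodory_type] with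
   its sigma-algebra; it only excludes the empty metric space. *)
#[short(type="pmetricType")]
HB.structure Definition PMetric (K : numDomainType) :=
  {M of Metric K M & Pointed M}.

Section space.
Context {R : realType} {P : pmetricType R}.
Variable mu : {outer_measure set P -> \bar R}.

Definition borel_regular :=
  (forall B : set P, <<s [set U : set P | open U] >> B ->
     mu.-caratheodory B) /\
  (forall A : set P, exists B : set P,
     [/\ <<s [set U : set P | open U] >> B, A `<=` B & mu B = mu A]).

Definition balls_pos_finite := forall (x : P) (r : R), (0 < r)%R ->
  0 < mu (ball x r) /\ mu (ball x r) < +oo.

Definition doubling := exists2 cd : R, (0 < cd)%R &
  forall (x : P) (r : R), (0 < r)%R ->
    mu (ball x (2 * r)%R) <= cd%:E * mu (ball x r).

(* Measurability, null sets and integrals always refer to the measure induced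
   by [mu] on its Caratheodory sigma-algebra. *)
Definition cmeas : set (caratheodory_type mu) -> \bar R := mu.

HB.instance Definition _ := Measure.copy cmeas
  (mu : set (caratheodory_type mu) -> \bar R).

Definition mu_measurable (u : P -> \bar R) :=
  measurable_fun [set: caratheodory_type mu] (u : caratheodory_type mu -> _).

Definition L0 : set (P -> \bar R) :=
  [set u | mu_measurable u /\
     {ae cmeas, forall x : caratheodory_type mu, u x \is a fin_num}].

Definition mavg (u : P -> \bar R) (A : set P) : \bar R :=
  (mu A)^-1 * \int[cmeas]_(y in A) u y.

Definition maximal (rho : R) (u : P -> \bar R) (x : P) : \bar R :=
  ereal_sup [set mavg (fun y => `|u y|) (ball x r)
            | r in [set r : R | (0 < r < rho)%R]].

(* The first clause says that the averages are meaningful: the integrals of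
   the positive and negative parts of [u] are not both infinite. *)
Definition lebesgue_point (u : P -> \bar R) (x : P) :=
  (\forall r \near (0%R : R)^'+,
     (\int[cmeas]_(y in ball x r) u^\+ y)
       +? (- \int[cmeas]_(y in ball x r) u^\- y)) /\
  (mavg u (ball x r) @[r --> (0%R : R)^'+] --> u x).

Definition extnorm (X : set (P -> \bar R)) (N : (P -> \bar R) -> R)
  (f : P -> \bar R) : \bar R := if `[< X f >] then (N f)%:E else +oo.

Definition mulchi (f : P -> \bar R) (E : set P) : P -> \bar R :=
  fun x => f x * (\1_E x)%:E.

(* Functions are not identified when they agree almost everywhere.  The values
   of pointwise sums at points where both summands are infinite are irrelevant
   since members of [L0] are almost everywhere finite. *)
Record qbfs := Qbfs {
  qcarrier : set (P -> \bar R) ;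
  qnorm : (P -> \bar R) -> R ;
  qsubL0 : qcarrier `<=` L0 ;
  q0 : qcarrier (cst 0) ;
  qD : forall f g, qcarrier f -> qcarrier g -> qcarrier (fun x => f x + g x)%E ;
  qZ : forall (a : R) f, qcarrier f -> qcarrier (fun x => a%:E * f x)%E ;
  qnorm_ge0 : forall f, qcarrier f -> (0 <= qnorm f)%R ;
  qnorm_eq0 : forall f, qcarrier f ->
    (qnorm f = 0%R <-> {ae cmeas, forall x : caratheodory_type mu, f x = 0}) ;
  qnormZ : forall (a : R) f, qcarrier f ->
    qnorm (fun x => a%:E * f x)%E = (`|a| * qnorm f)%R ;
  qnormD : exists cD : R, forall f g, qcarrier f -> qcarrier g ->
    (qnorm (fun x => f x + g x)%E <= cD * (qnorm f + qnorm g))%R ;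
  qcomplete : forall f_ : nat -> P -> \bar R, (forall k, qcarrier (f_ k)) ->
    (forall e : R, (0 < e)%R -> exists k0 : nat, forall m n : nat,
       (k0 <= m)%N -> (k0 <= n)%N ->
       (qnorm (fun x => f_ m x - f_ n x)%E < e)%R) ->
    exists2 f, qcarrier f &
      qnorm (fun x => f_ k x - f x)%E @[k --> \oo] --> (0 : R)%R ;
  qideal : forall f g, qcarrier g -> mu_measurable f ->
    {ae cmeas, forall x : caratheodory_type mu, `|f x| <= `|g x|} ->
    qcarrier f /\ (qnorm f <= qnorm g)%R ;
  qchi : forall E : set P, mu.-caratheodory E -> mu E < +oo ->
    qcarrier (EFin \o \1_E) ;
  qfatou : forall (f_ : nat -> P -> \bar R) (f : P -> \bar R),
    (forall k, mu_measurable (f_ k)) -> mu_measurable f ->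
    {ae cmeas, forall x : caratheodory_type mu, [/\ forall k, 0 <= f_ k x,
       nondecreasing_seq (f_ ^~ x) & f_ k x @[k --> \oo] --> f x]} ->
    nondecreasing_seq (fun k => extnorm qcarrier qnorm (f_ k)) /\
    (extnorm qcarrier qnorm (f_ k) @[k --> \oo] --> extnorm qcarrier qnorm f)
}.

Section hajlasz.
Variable X : qbfs.

Definition xnorm : (P -> \bar R) -> \bar R := extnorm (qcarrier X) (qnorm X).

Definition absolutely_continuous_norm :=
  forall (f : P -> \bar R) (E_ : nat -> set P), qcarrier X f ->
    (forall k, mu.-caratheodory (E_ k)) ->
    (forall k, E_ k.+1 `<=` E_ k) -> \bigcap_k E_ k = set0 ->
    xnorm (mulchi f (E_ k)) @[k --> \oo] --> 0.

Variable s : R.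

(* With the library conventions [`|+oo - +oo| = +oo] and [0 * +oo = 0], all
   points where [u] is infinite lie in [E] (take x = y). *)
Definition gradients (u : P -> \bar R) : set (P -> \bar R) :=
  [set g | [/\ mu_measurable g, forall x, 0 <= g x &
     exists E : set P, mu E = 0 /\ forall x y, ~ E x -> ~ E y ->
       `|u x - u y| <= (powR (mdist x y) s)%:E * (g x + g y)]].

Definition hajlasz_seminorm (u : P -> \bar R) : \bar R :=
  ereal_inf [set xnorm g | g in gradients u].

Definition hajlasz_hom : set (P -> \bar R) :=
  [set u | L0 u /\ hajlasz_seminorm u < +oo].

Definition hajlasz : set (P -> \bar R) := hajlasz_hom `&` qcarrier X.

Definition hajlasz_norm (u : P -> \bar R) : \bar R :=
  xnorm u + hajlasz_seminorm u.

Definition capacity (E : set P) : \bar R :=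
  ereal_inf [set hajlasz_norm u | u in [set u | hajlasz u /\
    exists U : set P, [/\ open U, E `<=` U & forall x, U x -> 1 <= u x]]].

Definition quasieverywhere (A : P -> Prop) :=
  exists F : set P, capacity F = 0 /\ forall x, ~ F x -> A x.

Definition quasicontinuous (u : P -> \bar R) :=
  forall e : R, (0 < e)%R -> exists E : set P,
    capacity E < e%:E /\ {within ~` E, continuous u}.

End hajlasz.
End space.

Arguments cmeas {R P} mu _.

(* Main.v *)
Require Import Defs.
From mathcomp Require Import all_boot all_order all_algebra.
From mathcomp Require Import all_classical all_reals all_analysis.
From mathcomp Require Import measurable_realfun.
From mathcomp Require Import ring lra.

Set Implicit Arguments.
Unset Strict Implicit.
Unset Printing Implicit Defensive.
Import Order.TTheory GRing.Theory Num.Theory.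
Import numFieldNormedType.Exports.

Local Open Scope classical_set_scope.
Local Open Scope ring_scope.
Local Open Scope ereal_scope.

(** Let [g] be a gradient of [u] in [X]; it may be taken finite everywhere.
    Three facts combine.

    A Poincare inequality at the critical exponent [q = Q / (Q + s)]. If the
    [q]-average of [g] over [ball x (2 * r)] is at most a small multiple of
    [lam `^ q], then starting from a point of [ball x r] one can jump from level
    set to level set of [g], halving the level each time, until a level near
    [lam] is reached. The lower mass bound makes the jumps geometrically short,
    and because [1 - q * s / Q = q] the accumulated oscillation is at most a
    multiple of [r `^ s * lam * (1 + (g y / lam) `^ q)], whose average over the
    ball is again of the order of [r `^ s * lam] ([pointwise_bound],
    [mean_lower]). Only a one-sided bound on [u] over a large part of the ball
    is used, so that infinite values of [u] need no separate treatment: the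
    bound is applied to [u] and to [- u] ([good_lebesgue]).

    Hence [x] is a Lebesgue point as soon as (i) [u] restricted to the
    complement of some [E] is continuous at [x] and [E] fills less than half of
    every small ball around [x], and (ii) [r `^ s] times the [q]-mean of [g]
    over [ball x r], that is, the [1 / q]-th power of the average of [g `^ q],
    tends to zero with [r].

    Failure of (i) or (ii) has small capacity ([capacity_bad]). Let [v] test the
    capacity of [E], with gradient [p]. If a ball of radius [r] is half filled
    by [E] and [v] is below one half at one of its points, then [p] at this
    point or the [q]-mean of [p] over the ball is of the order of [r `^ (- s)].
    So both failures yield balls on which, as far as [v] is small there, the
    sum of [p] and of the [q]-maximal function of [p] dominates the slope of a
    bump of height one. The supremum of [v] and all these bumps therefore has a
    gradient comparable to this sum, and it is a test function for all these
    balls at once ([capacity_bumps]). For (ii) the gradient is first truncated: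
    the bounded part of [g] contributes nothing in the limit, and its upper part
    has small norm by absolute continuity ([small_exception]).

    Finally the exceptional sets are united. A quasinorm gives no countable
    subadditivity, but norms that decay fast enough can be summed
    ([capacity_bigcup]). *)

(** * Chaining along the level sets of a gradient *)

Section chaining.
Context {R : realType} {P : pmetricType R}.
Local Open Scope ring_scope.

Variables (s q lam r bet : R) (x0 : P) (N : set P) (v g : P -> R).
Hypotheses (s_gt0 : 0 < s) (s_le1 : s <= 1) (q_gt0 : 0 < q).
Hypotheses (bet_gt0 : 0 < bet) (bet_lt1 : bet < 1).
Hypothesis betE : 2 * bet `^ s = 2 `^ q.
Hypotheses (lam_gt0 : 0 < lam) (r_gt0 : 0 < r).
Hypothesis vg : forall x y, ~ N x -> ~ N y ->
  v x <= v y + mdist x y `^ s * (g x + g y).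
Hypothesis base : exists z, [/\ mdist x0 z < r, ~ N z, g z <= lam & v z <= 0].
Hypothesis step : forall n y, mdist x0 y < r * (1 + bet ^+ n.+1) ->
  exists y', [/\ mdist y y' < r * bet ^+ n * (1 - bet), ~ N y'
               & g y' <= 2 ^+ n * lam].

(** The fixed part pays for the last jump, which has length up to [3 * r]; the
    quotient sums the geometric series of the earlier ones. *)
Definition chain_const := 6 + 4 / (2 `^ q - 1).

Let b_gt1 : 1 < 2 `^ q.
Proof. by rewrite -[ltLHS](congr1 (fun f => f q) (powR1 R)) gt0_ltr_powR ?nnegrE// ltr1n. Qed.

Lemma chain_const_ge0 : 0 <= chain_const.
Proof. by rewrite addr_ge0// divr_ge0// subr_ge0 ltW. Qed.

(** One jump from level [2 ^+ n.+1 * lam] to level [2 ^+ n * lam] costs a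
    multiple of [r `^ s * (bet `^ s) ^+ n * 2 ^+ n * lam], and
    [2 * bet `^ s = 2 `^ q] turns these costs into a geometric series of ratio
    [2 `^ q]. The admissible radius grows as the level drops, from [r] towards
    [2 * r], which is the room taken up by the jumps. *)
Lemma chain_level n y : ~ N y -> mdist x0 y < r * (1 + bet ^+ n) ->
  g y <= 2 ^+ n * lam -> v y <= chain_const * r `^ s * lam * (2 `^ q) ^+ n.
Proof.
have D6 : 6 <= chain_const by rewrite lerDl divr_ge0// subr_ge0 ltW.
have rs := powR_ge0 r s.
elim: n y => [|n IH] y Ny.
  rewrite !expr0 mul1r mulr1 => xy gy; have [z [xz Nz gz vz]] := base.
  have yz : mdist y z <= 3 * r.
    by have := metric_triangle y x0 z; rewrite (metric_sym y x0); lra.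
  have dS : mdist y z `^ s <= 3 * r `^ s.
    apply: (@le_trans _ _ ((3 * r) `^ s)).
      by rewrite ge0_ler_powR ?nnegrE ?mdist_ge0// ltW// mulr_gt0.
    rewrite powRM ?(ltW r_gt0)//; apply: ler_wpM2r => //.
    by rewrite ler1_powR// ler1n.
  have := vg Ny Nz; have := powR_ge0 (mdist y z) s.
  set d := mdist y z `^ s in dS * => d0 H.
  have : d * (g y + g z) <= d * (2 * lam) by apply: ler_wpM2l => //; lra.
  have : d * (2 * lam) <= 3 * r `^ s * (2 * lam).
    by apply: ler_wpM2r => //; rewrite mulr_ge0// ltW.
  have : 6 * (r `^ s * lam) <= chain_const * (r `^ s * lam).
    by apply: ler_wpM2r => //; rewrite mulr_ge0// ltW.
  by rewrite -!mulrA; lra.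
move=> xy gy; have [y' [yy' Ny' gy']] := step xy.
have bn : 0 < bet ^+ n by rewrite exprn_gt0.
have xy' : mdist x0 y' < r * (1 + bet ^+ n).
  have := metric_triangle x0 y y'; rewrite exprS in xy; lra.
have vy' := IH _ Ny' xy' gy'.
have dS : mdist y y' `^ s <= r `^ s * (bet `^ s) ^+ n.
  have -> : (bet `^ s) ^+ n = (bet ^+ n) `^ s.
    by rewrite -(powR_mulrn _ (powR_ge0 _ _)) -(powR_mulrn _ (ltW bet_gt0)) powRAC.
  rewrite -powRM ?(ltW r_gt0) ?(ltW bn)//.
  apply: ge0_ler_powR; rewrite ?nnegrE ?mdist_ge0 ?(ltW s_gt0)//.
    by rewrite mulr_ge0// ltW.
  rewrite ltW// (lt_le_trans yy')// ler_piMr//; last by rewrite gerBl ltW.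
  by rewrite mulr_ge0// ltW.
have := vg Ny Ny'; have := powR_ge0 (mdist y y') s.
set d := mdist y y' `^ s in dS * => d0 H.
have E : (bet `^ s) ^+ n * 2 ^+ n = (2 `^ q) ^+ n by rewrite -exprMn mulrC betE.
have l2 : 0 < 2 ^+ n * lam by rewrite mulr_gt0// exprn_gt0.
have : d * (g y + g y') <= d * (4 * (2 ^+ n * lam)).
  by apply: ler_wpM2l => //; move: gy; rewrite exprS -mulrA; lra.
have : d * (4 * (2 ^+ n * lam)) <=
    r `^ s * (bet `^ s) ^+ n * (4 * (2 ^+ n * lam)).
  by apply: ler_wpM2r => //; rewrite mulr_ge0// ltW.
have -> : r `^ s * (bet `^ s) ^+ n * (4 * (2 ^+ n * lam)) =
    4 * (r `^ s * lam * (2 `^ q) ^+ n) by rewrite -E; ring.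
rewrite exprS.
have B1 := b_gt1; set B := 2 `^ q in B1 vy' *.
set T := r `^ s * lam * B ^+ n.
have T0 : 0 <= T.
  by rewrite mulr_ge0 ?exprn_ge0 ?mulr_ge0 ?powR_ge0 ?(ltW lam_gt0).
have K : chain_const + 4 <= chain_const * B.
  have : 4 <= chain_const * (B - 1).
    by rewrite /chain_const -/B mulrDl divfK ?gt_eqF ?subr_gt0//; lra.
  by lra.
have : (chain_const + 4) * T <= chain_const * B * T by apply: ler_wpM2r.
have -> : chain_const * r `^ s * lam * (B * B ^+ n) = chain_const * B * T.
  by rewrite /T; ring.
have : v y' <= chain_const * T by rewrite /T !mulrA.
lra.
Qed.

(** The least admissible level of [y] is comparable to [g y], unless it is the
    bottom one. *)
Lemma chain_bound y : ~ N y -> mdist x0 y < r -> 0 <= g y -> q <= 1 ->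
  v y <= chain_const * r `^ s * lam * (1 + 2 * (g y / lam) `^ q).
Proof.
move=> Ny xy g0 q1.
have D0 := chain_const_ge0.
have C0 : 0 <= chain_const * r `^ s * lam.
  by rewrite !mulr_ge0 ?powR_ge0// ltW.
have exn : exists n, g y <= 2 ^+ n * lam.
  exists (Num.bound (g y / lam)); rewrite -ler_pdivrMr//.
  rewrite ltW// (lt_le_trans (archi_boundP _))//; first by rewrite divr_ge0// ltW.
  by rewrite -natrX ler_nat ltnW// ltn_expl.
case: (ex_minnP exn) => n gn nmin.
apply: (le_trans (chain_level Ny _ gn)).
  rewrite (lt_le_trans xy)// ler_peMr ?ltW// ltrDl exprn_gt0//.
apply: ler_wpM2l => //.
case: n gn nmin => [|n] gn nmin.
  by rewrite expr0 lerDl mulr_ge0// powR_ge0.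
have gt : 2 ^+ n <= g y / lam.
  rewrite ler_pdivlMr// leNgt; apply/negP => /ltW /nmin.
  by rewrite ltnn.
have -> : (2 `^ q) ^+ n.+1 = 2 `^ q * (2 ^+ n) `^ q.
  by rewrite exprS -(powR_mulrn _ (powR_ge0 _ _)) -(powR_mulrn _ (ler0n R 2)) powRAC.
apply: (@le_trans _ _ (2 * (g y / lam) `^ q)); last by rewrite lerDr.
apply: ler_pM; rewrite ?powR_ge0//.
  by rewrite ler1_powR// ler1n.
by rewrite ge0_ler_powR ?nnegrE ?exprn_ge0 ?divr_ge0 ?(ltW q_gt0) ?(ltW lam_gt0).
Qed.

End chaining.

(** * Mass of balls and a Sobolev--Poincare inequality *)

Section measure.
Context {R : realType} {P : pmetricType R}.
Variable mu : {outer_measure set P -> \bar R}.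
Local Notation T := (caratheodory_type mu).
Hypothesis mu_regular : borel_regular mu.

Lemma open_caratheodory (U : set P) : open U -> measurable (U : set T).
Proof. by move=> oU; apply: mu_regular.1; exact: sub_sigma_algebra. Qed.

Lemma metric_ball_open (x : P) (r : R) : open (ball x r).
Proof.
rewrite openE => y /=; rewrite ballEmdist /= => xy.
rewrite /interior; apply/nbhs_ballP; exists (r - mdist x y)%R => /=.
  by rewrite subr_gt0.
move=> z; rewrite !ballEmdist /= => yz.
by rewrite (le_lt_trans (metric_triangle x y z))// -ltrBrDl.
Qed.

Lemma ball_caratheodory (x : P) (r : R) : measurable (ball x r : set T).
Proof. exact/open_caratheodory/metric_ball_open. Qed.

Lemma null_negligible (N : set P) : mu N = 0 -> (cmeas mu).-negligible N.
Proof.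
move=> N0; suff mN : mu.-caratheodory N.
  by exists N; split; [exact: mN|exact: N0|].
apply: le_caratheodory_measurable => X.
have -> : mu (X `&` N) = 0.
  apply/eqP; rewrite eq_le outer_measure_ge0 andbT -N0.
  by apply: le_outer_measure; exact: subIsetr.
by rewrite add0e; apply: le_outer_measure; exact: subIsetl.
Qed.

Lemma negligible_null (N : set P) : (cmeas mu).-negligible N -> mu N = 0.
Proof.
move=> [A [_ A0 NA]]; apply/eqP; rewrite eq_le outer_measure_ge0 andbT.
by rewrite -A0; exact: le_outer_measure.
Qed.

(** The Chebyshev inequality for an arbitrary set [S]: it is applied to
    complements of exceptional sets, about whose measurability nothing is
    known. *)
Lemma chebyshev_outer (f : P -> \bar R) (A S N : set P) (a : R) :
  measurable (A : set T) -> measurable_fun (A : set T) (f : T -> \bar R) ->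
  (forall z, 0 <= f z) -> mu N = 0 -> (0 <= a)%R -> S `<=` A ->
  (forall z, S z -> ~ N z -> a%:E <= f z) ->
  a%:E * mu S <= \int[cmeas mu]_(z in A) f z.
Proof.
move=> mA mf f0 N0 a0 SA Sf.
have mS' : measurable (A `&` [set z | a%:E <= f z] : set T).
  by apply: emeasurable_fun_c_infty.
set S' := A `&` _ in mS'.
apply: (@le_trans _ _ (a%:E * mu S')).
  rewrite lee_wpmul2l ?lee_fin//.
  have SS : S `<=` S' `|` N.
    move=> z Sz; have [Nz|Nz] := pselect (N z); [by right|left].
    by split; [exact: SA|exact: Sf].
  apply: (le_trans (le_outer_measure mu _ _ SS)).
  by apply: (le_trans (outer_measureU2 mu _ _)); rewrite N0 adde0.
apply: (@le_trans _ _ (\int[cmeas mu]_(z in S') (cst a%:E z))).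
  by rewrite integral_cst.
apply: (@le_trans _ _ (\int[cmeas mu]_(z in S') f z)).
  apply: ge0_le_integral => //.
  - by apply: measurable_funS mf => //; exact: subIsetl.
  - by move=> z; rewrite /S' => -[_].
by apply: ge0_subset_integral => //; exact: subIsetl.
Qed.

Hypothesis mu_balls : balls_pos_finite mu.

Lemma ball_fin (x : P) (r : R) : (0 < r)%R ->
  exists2 m : R, (0 < m)%R & mu (ball x r) = m%:E.
Proof.
move=> r0; have [] := mu_balls x r0.
by case: (mu (ball x r)) => [m| |] //; rewrite lte_fin => m0 _; exists m.
Qed.

Variables (s c Q : R).
Hypotheses (s_gt0 : (0 < s)%R) (s_le1 : (s <= 1)%R).
Hypotheses (c_gt0 : (0 < c)%R) (Q_gt0 : (0 < Q)%R).
Hypothesis mu_lower : forall (x y : P) (r rho : R),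
  (0 < r)%R -> (r <= rho)%R -> ball x rho y ->
  (c * powR (r / rho) Q)%:E <= mu (ball y r) * (mu (ball x rho))^-1.

Lemma lower_mass (x y : P) (r rho : R) :
  (0 < r)%R -> (r <= rho)%R -> ball x rho y ->
  (c * powR (r / rho) Q)%:E * mu (ball x rho) <= mu (ball y r).
Proof.
move=> r0 rrho xy; have := mu_lower r0 rrho xy.
have [m m0 ->] := ball_fin x (lt_le_trans r0 rrho).
by rewrite inver gt_eqF// lee_pdivlMr.
Qed.

Local Notation q := (Q / (Q + s))%R.
Local Notation bet := (powR 2 (- (q / Q)))%R.

Let Qs_gt0 : (0 < Q + s)%R. Proof. by rewrite addr_gt0. Qed.
Let q_gt0 : (0 < q)%R. Proof. by rewrite divr_gt0. Qed.
Let q_le1 : (q <= 1)%R.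
Proof. by rewrite ler_pdivrMr// mul1r lerDl ltW. Qed.
Let bet_gt0 : (0 < bet)%R. Proof. by rewrite powR_gt0. Qed.
Let bet_lt1 : (bet < 1)%R.
Proof.
rewrite powRN invf_lt1 ?powR_gt0//.
rewrite -[ltLHS](congr1 (fun f => f (q / Q)%R) (powR1 R)).
by rewrite gt0_ltr_powR ?nnegrE ?divr_gt0// ltr1n.
Qed.

Let betE : (2 * powR bet s = powR 2 q)%R.
Proof.
rewrite -powRrM -{1}(powRr1 (ler0n R 2)) -powRD; last first.
  by rewrite pnatr_eq0 implybT.
by congr (powR 2 _); field; rewrite !gt_eqF.
Qed.

Let betQ : (powR bet Q = (powR 2 q)^-1)%R.
Proof. by rewrite -powRrM -powRN; congr (powR 2 _); field; rewrite !gt_eqF. Qed.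

(** Half the fraction of the mass of [ball x0 (2 * r)] that the lower mass bound
    guarantees to a ball of radius [r * (1 - bet)] inside it. *)
Definition chain_frac := (c * powR ((1 - bet) / 2) Q / 2)%R.

Lemma chain_frac_gt0 : (0 < chain_frac)%R.
Proof. by rewrite divr_gt0// mulr_gt0// powR_gt0// divr_gt0// subr_gt0. Qed.

(** If no point of the small ball were at the lower level, the whole ball would
    lie in a superlevel set of [g] up to a null set; its mass, bounded below by the power [Q] of
    the radius, would then violate the Chebyshev inequality. The radii shrink
    by the factor [bet] because [bet `^ Q = (2 `^ q)^-1]. *)
Lemma level_step (x0 : P) (r lam : R) (N : set P) (g : P -> R) :
  (0 < r)%R -> (0 < lam)%R -> mu N = 0 -> (forall x, (0 <= g x)%R) ->
  mu_measurable mu (EFin \o g) ->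
  \int[cmeas mu]_(y in ball x0 (2 * r)) (powR (g y) q)%:E
    <= (chain_frac * powR lam q)%:E * mu (ball x0 (2 * r)) ->
  forall n y, (mdist x0 y < r * (1 + bet ^+ n.+1))%R ->
  exists y', [/\ (mdist y y' < r * bet ^+ n * (1 - bet))%R, ~ N y'
               & (g y' <= 2 ^+ n * lam)%R].
Proof.
move=> r0 lam0 N0 g0 mg Ig n y xy.
have bn : (0 < bet ^+ n)%R by rewrite exprn_gt0.
have bn1 : (bet ^+ n <= 1)%R by rewrite exprn_ile1// ltW.
have bN : (0 < 1 - bet)%R by rewrite subr_gt0.
have b1 := bet_lt1; have b0 := bet_gt0.
set rho := (r * bet ^+ n * (1 - bet))%R.
have rho0 : (0 < rho)%R by rewrite !mulr_gt0.
have r20 : (0 < 2 * r)%R by rewrite mulr_gt0.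
have rho2 : (rho <= 2 * r)%R.
  rewrite /rho -mulrA mulrC; apply: ler_wpM2r; first exact: ltW.
  by apply: (@le_trans _ _ (1 * 1)%R); [apply: ler_pM; lra|lra].
have sub : (r * (1 + bet ^+ n.+1) + rho <= 2 * r)%R.
  have -> : (r * (1 + bet ^+ n.+1) + rho = (1 + bet ^+ n) * r)%R.
    by rewrite /rho exprS; ring.
  by apply: ler_wpM2r; [exact: ltW|lra].
apply: contrapT => /forallNP H.
have xy2 : ball x0 (2 * r) y by rewrite ballEmdist /=; lra.
have := lower_mass rho0 rho2 xy2.
have [M M0 EM] := ball_fin x0 r20.
have [m m0 Em] := ball_fin y rho0.
rewrite EM in Ig *; rewrite Em.
have cheb : (powR (2 ^+ n * lam) q)%:E * mu (ball y rho) <=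
    \int[cmeas mu]_(y in ball x0 (2 * r)) (powR (g y) q)%:E.
  apply: (chebyshev_outer (N := N)) => //.
  - exact: ball_caratheodory.
  - apply: measurable_funTS.
    have -> : (fun z => (powR (g z) q)%:E) =
        (fun z => poweR ((EFin \o g) z) q) by [].
    exact: (measurableT_comp (measurable_poweR _) mg).
  - by move=> z; rewrite lee_fin powR_ge0.
  - exact: powR_ge0.
  - move=> z; rewrite !ballEmdist /= => yz.
    by have := metric_triangle x0 y z; lra.
  - move=> z; rewrite ballEmdist /= => yz Nz.
    rewrite lee_fin; apply: ge0_ler_powR;
      rewrite ?nnegrE ?(ltW q_gt0) ?mulr_ge0 ?exprn_ge0 ?(ltW lam0)//.
    by rewrite leNgt; apply/negP => /ltW gz; apply: (H z); split.
have := le_trans cheb Ig.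
rewrite Em -!EFinM !lee_fin.
have -> : (powR (2 ^+ n * lam) q = (powR 2 q) ^+ n * powR lam q)%R.
  rewrite powRM ?exprn_ge0 ?(ltW lam0)//; congr (_ * _)%R.
  by rewrite -(powR_mulrn _ (powR_ge0 _ _)) -(powR_mulrn _ (ler0n R 2)) powRAC.
have -> : (rho / (2 * r) = bet ^+ n * ((1 - bet) / 2))%R.
  by rewrite /rho; field; rewrite gt_eqF.
have -> : (powR (bet ^+ n * ((1 - bet) / 2)) Q =
    (powR 2 q) ^- n * powR ((1 - bet) / 2) Q)%R.
  rewrite powRM ?(ltW bn) ?divr_ge0 ?(ltW bN)//; congr (_ * _)%R.
  rewrite -(powR_mulrn _ (ltW b0)) powRAC betQ powR_mulrn ?exprVn//.
have B0 : (0 < powR 2 q ^+ n :> R)%R by rewrite exprn_gt0// powR_gt0.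
have l0 : (0 < powR lam q)%R by rewrite powR_gt0.
have -> : (chain_frac * powR lam q * M = powR lam q * (chain_frac * M))%R by ring.
rewrite mulrAC mulrC ler_pM2l//.
have -> : (c * (powR 2 q ^- n * powR ((1 - bet) / 2) Q) * M =
   (2 * (chain_frac * M)) / (powR 2 q ^+ n))%R.
  by rewrite /chain_frac; field; rewrite gt_eqF.
rewrite ler_pdivrMr// => h1 h2.
have : (0 < chain_frac * M)%R by rewrite mulr_gt0// chain_frac_gt0.
by rewrite mulrC in h2; lra.
Qed.

(** A Sobolev--Poincare inequality at the critical exponent in pointwise form:
    the right-hand side is integrable with mean of the order of
    [r `^ s * lam]. *)
Lemma pointwise_bound (x0 : P) (r lam : R) (N : set P) (v g : P -> R) :
  (0 < r)%R -> (0 < lam)%R -> mu N = 0 -> (forall x, (0 <= g x)%R) ->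
  mu_measurable mu (EFin \o g) ->
  (forall x y, ~ N x -> ~ N y ->
     (v x <= v y + powR (mdist x y) s * (g x + g y))%R) ->
  \int[cmeas mu]_(y in ball x0 (2 * r)) (powR (g y) q)%:E
    <= (chain_frac * powR lam q)%:E * mu (ball x0 (2 * r)) ->
  (exists z, [/\ ball x0 r z, ~ N z, (g z <= lam)%R & (v z <= 0)%R]) ->
  forall y, ball x0 r y -> ~ N y ->
    (v y <= chain_const q * powR r s * lam * (1 + 2 * powR (g y / lam) q))%R.
Proof.
move=> r0 lam0 N0 g0 mg vg Ig [z [xz Nz gz vz]] y xy Ny.
apply: (@chain_bound _ _ s q lam r bet x0 N v g) => //.
- by exists z; split => //; move: xz; rewrite ballEmdist.
- exact: level_step Ig.
- by move: xy; rewrite ballEmdist.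
Qed.

End measure.

(** * Real-valued members of a quasi-Banach function space *)

Section space.
Context {R : realType} {P : pmetricType R}.
Variable mu : {outer_measure set P -> \bar R}.
Local Notation T := (caratheodory_type mu).
Variable X : qbfs mu.

(** Members of [X] are finite almost everywhere, and gradients and test functions
    only matter off a null set; so real-valued representatives suffice, and all
    pointwise arithmetic can be done in the reals. *)
Definition inX (f : P -> R) := qcarrier X (EFin \o f).
Definition nX (f : P -> R) : R := qnorm X (EFin \o f).

Lemma nX_ge0 f : inX f -> (0 <= nX f)%R.
Proof. exact: qnorm_ge0. Qed.

Lemma inX_measurable f : inX f -> mu_measurable mu (EFin \o f).
Proof. by move=> /qsubL0 []. Qed.

Lemma ae_off_null (A : P -> Prop) (N : set P) :
  mu N = 0 -> (forall x, ~ N x -> A x) ->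
  {ae cmeas mu, forall x : T, A x}.
Proof.
move=> /null_negligible Nn H.
suff : (cmeas mu).-negligible (~` (A : set T)) by [].
by apply: negligibleS Nn => x nAx; apply: contrapT => Nx; apply: nAx; exact: H.
Qed.

Lemma inX_le f g N : inX g -> mu_measurable mu (EFin \o f) -> mu N = 0 ->
  (forall x, ~ N x -> (`|f x| <= `|g x|)%R) -> inX f /\ (nX f <= nX g)%R.
Proof.
move=> Xg mf N0 fg; apply: qideal => //.
by apply: (ae_off_null N0) => x Nx; rewrite /= lee_fin fg.
Qed.

Lemma inXZ a f : inX f -> (0 <= a)%R ->
  inX (fun x => a * f x)%R /\ nX (fun x => a * f x)%R = (a * nX f)%R.
Proof.
move=> Xf a0; split; first exact: (qZ a Xf).
by have := qnormZ a Xf; rewrite ger0_norm.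
Qed.

Lemma inXD f g : inX f -> inX g -> inX (fun x => f x + g x)%R.
Proof. by move=> Xf Xg; exact: (qD Xf Xg). Qed.

Lemma quasi_triangle : exists2 K : R, (1 <= K)%R & forall f g,
  inX f -> inX g -> (nX (fun x => f x + g x) <= K * (nX f + nX g))%R.
Proof.
have [cD HD] := qnormD X.
exists (Num.max 1 cD)%R; first by rewrite le_max lexx.
move=> f g Xf Xg; apply: (le_trans (HD _ _ Xf Xg)).
by apply: ler_wpM2r; rewrite ?le_max ?lexx ?orbT// addr_ge0// nX_ge0.
Qed.

Lemma fine_inX (F : P -> \bar R) : qcarrier X F -> (forall x, 0 <= F x) ->
  [/\ inX (fine \o F), (nX (fine \o F) <= qnorm X F)%R &
     exists2 N, mu N = 0 & forall x, ~ N x -> F x = (fine (F x))%:E].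
Proof.
move=> XF F0; have [mF finF] := qsubL0 XF.
have mf : mu_measurable mu (EFin \o (fine \o F)).
  apply/measurable_EFinP; apply: (measurableT_comp _ mF).
  exact: fine_measurable.
have [] := @qideal _ _ _ X (EFin \o (fine \o F)) F XF mf.
  apply: aeW => x /=; have := F0 x.
  by case: (F x) => [a| |]//= _; rewrite ?normr0 ?lexx ?leey.
move=> ? ?; split => //.
exists (~` [set x | F x \is a fin_num]); first exact: negligible_null.
by move=> x /contrapT /fineK.
Qed.

Lemma extnorm_le (F : P -> \bar R) (b : R) :
  xnorm X F <= b%:E -> qcarrier X F /\ (qnorm X F <= b)%R.
Proof. by rewrite /xnorm /extnorm; case: asboolP. Qed.

Lemma xnormE (F : P -> \bar R) : qcarrier X F -> xnorm X F = (qnorm X F)%:E.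
Proof. by rewrite /xnorm /extnorm => XF; rewrite asboolT. Qed.

(** Geometric weights absorb the powers of the quasi-triangle constant, so that
    the partial sums stay bounded; their limit is in [X] by the Fatou
    property. *)
Lemma quasi_series (K e : R) (f : nat -> P -> R) :
  (0 < e)%R -> (1 <= K)%R ->
  (forall f g, inX f -> inX g ->
     (nX (fun x => f x + g x) <= K * (nX f + nX g))%R) ->
  (forall k x, (0 <= f k x)%R) ->
  (forall k, inX (f k) /\ (nX (f k) <= e / (2 * K) ^+ k.+1)%R) ->
  exists F N, [/\ inX F, (nX F <= e)%R, mu N = 0, forall x, (0 <= F x)%R &
    forall k x, ~ N x -> (f k x <= F x)%R].
Proof.
move=> e0 K1 HK f0 fX.
have K0 : (0 < 2 * K)%R by rewrite mulr_gt0// (lt_le_trans _ K1).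
have X0 : inX (fun=> 0%R) by exact: q0.
have N0 : nX (fun=> 0%R) = 0%R.
  by apply/(qnorm_eq0 X0); apply: aeW => x.
have part n : forall k, inX (fun x => \sum_(k <= i < n + k) f i x)%R /\
    (nX (fun x => \sum_(k <= i < n + k) f i x)%R <= e / (2 * K) ^+ k)%R.
  elim: n => [|n IH] k.
    have -> : (fun x => \sum_(k <= i < 0 + k) f i x)%R = fun=> 0%R.
      by apply/funext => x; rewrite add0n big_geq.
    by rewrite N0 divr_ge0 ?exprn_ge0 ?(ltW e0) ?(ltW K0).
  have -> : (fun x => \sum_(k <= i < n.+1 + k) f i x)%R =
     (fun x => f k x + \sum_(k.+1 <= i < n + k.+1) f i x)%R.
    apply/funext => x; rewrite big_ltn ?addSnnS//.
    by rewrite addnS ltnS leq_addl.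
  have [X1 n1] := fX k; have [X2 n2] := IH k.+1.
  split; first exact: inXD.
  apply: (le_trans (HK _ _ X1 X2)).
  have -> : (e / (2 * K) ^+ k = K * (e / (2 * K) ^+ k.+1 + e / (2 * K) ^+ k.+1))%R.
    by rewrite exprS; field; rewrite ?expf_neq0// ?gt_eqF//; lra.
  by apply: ler_wpM2l; [lra|exact: lerD].
pose F x : \bar R := \sum_(0 <= k <oo) (f k x)%:E.
pose S n x : \bar R := \sum_(0 <= k < n) (f k x)%:E.
have SE n : S n = EFin \o (fun x => \sum_(0 <= i < n + 0) f i x)%R.
  by apply/funext => x; rewrite /S /= sumEFin addn0.
have mf k : measurable_fun [set: T] (fun x : T => (f k x)%:E).
  exact: (inX_measurable (fX k).1).
have F0 x : 0 <= F x by apply: nneseries_ge0 => n _ _; rewrite lee_fin.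
have mF : mu_measurable mu F.
  have := @ge0_emeasurable_sum _ T R setT (fun k x => (f k x)%:E) xpredT.
  by apply => // k x _ _; rewrite lee_fin.
have mS k : mu_measurable mu (S k).
  by rewrite SE; exact: (inX_measurable (part k 0%N).1).
have aeS : {ae cmeas mu, forall x : T, [/\ forall k, 0 <= S k x,
    nondecreasing_seq (S ^~ x) & S k x @[k --> \oo] --> F x]}.
  apply: aeW => x; have fx0 n : 0 <= (f n x)%:E by rewrite lee_fin.
  split; first by move=> k; exact: sume_ge0.
  - by apply: ereal_nondecreasing_series.
  - exact: is_cvg_nneseries.
have [_ cv] := qfatou X mS mF aeS.
have Fe : xnorm X F <= e%:E.
  apply: (cvge_le _ cv); apply: nearW => k.
  rewrite SE -/(xnorm X _) xnormE ?lee_fin; last exact: (part k 0%N).1.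
  by have := (part k 0%N).2; rewrite expr0 divr1.
have [XF nF] := extnorm_le Fe.
have [XfF nfF [N N1 HN]] := fine_inX XF F0.
exists (fine \o F), N; split => //; first exact: le_trans nF.
  by move=> x; exact: fine_ge0.
move=> k x Nx; rewrite -lee_fin -HN//.
apply: (@le_trans _ _ (S k.+1 x)).
  rewrite /S big_nat_recr//= leeDr// sume_ge0// => i _.
  by rewrite lee_fin.
by apply: nneseries_lim_ge => n _ _; rewrite lee_fin.
Qed.

(** * Gradients and test functions of capacity *)

Variable s : R.
Hypothesis s_gt0 : (0 < s)%R.

Definition hgrad (u g : P -> R) (N : set P) :=
  [/\ mu N = 0, forall x, (0 <= g x)%R &
    forall x y, ~ N x -> ~ N y ->
      (`|u x - u y| <= powR (mdist x y) s * (g x + g y))%R].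

(** Off the exceptional set [u] is finite: the gradient inequality with [x = y]
    reads [`|u x - u x| <= 0]. *)
Lemma gradients_hgrad (u g : P -> \bar R) :
  gradients mu s u g -> qcarrier X g ->
  exists p N, [/\ inX p, (nX p <= qnorm X g)%R, hgrad (fine \o u) p N &
    forall x, ~ N x -> u x = (fine (u x))%:E].
Proof.
move=> [mg g0 [N1 [N10 ug]]] Xg.
have [Xp np [N2 N20 gE]] := fine_inX Xg g0.
have uE x : ~ N1 x -> u x = (fine (u x))%:E.
  move=> N1x; have := ug _ _ N1x N1x.
  rewrite mdistxx powR0 ?gt_eqF// mul0e.
  by case: (u x).
exists (fine \o g), (N1 `|` N2); split => //; last first.
  by move=> x /not_orP [/uE].
split.
- by apply/eqP; rewrite eq_le outer_measure_ge0 andbT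
    (le_trans (outer_measureU2 mu _ _))// N10 N20 adde0.
- by move=> x; exact: fine_ge0.
- move=> x y /not_orP [x1 x2] /not_orP [y1 y2].
  have := ug _ _ x1 y1; rewrite (uE _ x1) (uE _ y1) (gE _ x2) (gE _ y2).
  by rewrite -EFinD -EFinM.
Qed.

Lemma capacity_le (w G : P -> R) (N U F : set P) :
  inX w -> inX G -> hgrad w G N -> open U -> F `<=` U ->
  (forall x, U x -> (1 <= w x)%R) ->
  capacity X s F <= (nX w + nX G)%:E.
Proof.
move=> Xw XG [N0 G0 wG] oU FU w1.
have semi : hajlasz_seminorm X s (EFin \o w) <= (nX G)%:E.
  apply: ereal_inf_lbound; exists (EFin \o G); last exact: xnormE.
  split; first exact: inX_measurable.
    by move=> x; rewrite /= lee_fin.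
  by exists N; split.
apply: (@le_trans _ _ (hajlasz_norm X s (EFin \o w))).
  apply: ereal_inf_lbound; exists (EFin \o w) => //; split.
    split => //; split; first exact: (qsubL0 Xw).
    by rewrite (le_lt_trans semi)// ltry.
  by exists U; split => // x Ux; rewrite /= lee_fin w1.
by rewrite EFinD /hajlasz_norm xnormE// leeD2l.
Qed.

Definition clamp (a : R) : R := (Num.min 1 (Num.max 0 a))%R.

Lemma clamp_lip a b : (`|clamp a - clamp b| <= `|a - b|)%R.
Proof.
have h1 : (a - b <= `|a - b|)%R by exact: ler_norm.
have h2 : (b - a <= `|a - b|)%R by rewrite distrC; exact: ler_norm.
rewrite ler_norml /clamp /Num.min /Num.max; set n := `|_|%R in h1 h2 *.
have [a0|a0] := ltP 0%R a; have [b0|b0] := ltP 0%R b;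
  have [a1|a1] := ltP 1%R a; have [b1|b1] := ltP 1%R b;
  rewrite ?(ltr01) ?(ltr10); apply/andP; split; lra.
Qed.

(** Truncation to the unit interval preserves gradients and does not increase
    the norm, so that test functions may be taken bounded. *)
Lemma capacity_test (E : set P) (e : R) : capacity X s E < e%:E ->
  exists v p U N, [/\ inX v, inX p, (nX v < e)%R & (nX p < e)%R] /\
    [/\ open U, E `<=` U, forall x, U x -> v x = 1%R,
        forall x, (0 <= v x <= 1)%R & hgrad v p N].
Proof.
move=> /ereal_inf_lt [_ [v0 [[[L0v semi] Xv] [U [oU EU v1]]] <-]].
rewrite /hajlasz_norm xnormE// => lt_e.
have n0 : (0 <= qnorm X v0)%R by exact: qnorm_ge0.
have semi_lt : hajlasz_seminorm X s v0 < (e - qnorm X v0)%:E.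
  by rewrite EFinB lteBrDl.
have [_ [g gv <-] xg] := ereal_inf_lt semi_lt.
have [Xg ng] := extnorm_le (ltW xg).
rewrite xnormE// lte_fin in xg.
have g_ge0 : (0 <= qnorm X g)%R by exact: qnorm_ge0.
have [p [N [Xp np [N0 p0 vp] vE]]] := gradients_hgrad gv Xg.
pose v x := fine (mine 1 (maxe 0 (v0 x))).
have vE' x : mine 1 (maxe 0 (v0 x)) = (v x)%:E.
  rewrite /v fineK// ge0_fin_numE ?le_min ?le_max ?lexx ?lee01//.
  by rewrite gt_min ltry.
have v01 x : (0 <= v x <= 1)%R.
  by rewrite -!lee_fin -vE' le_min ge_min le_max !lexx lee01.
have mv : mu_measurable mu (EFin \o v).
  have -> : EFin \o v = fun x => mine 1 (maxe 0 (v0 x)).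
    by apply/funext => x; rewrite /= vE'.
  apply: measurable_mine => //; apply: measurable_maxe => //.
  exact: (qsubL0 Xv).1.
have [Xv' nv'] : qcarrier X (EFin \o v) /\ (nX v <= qnorm X v0)%R.
  apply: qideal => //; apply: aeW => x; rewrite /= ger0_norm; last first.
    by have /andP[] := v01 x.
  rewrite -vE' ge_min ge_max abse_ge0 lee_abs orbT//.
exists v, p, U, N; split; split => //.
- apply: (le_lt_trans nv'); lra.
- apply: (le_lt_trans np); lra.
- move=> x /v1 v1x; apply: EFin_inj; rewrite -vE'.
  by apply/min_idPl; rewrite le_max v1x orbT.
- split => // x y Nx Ny.
  have vC z : ~ N z -> v z = clamp (fine (v0 z)).
    by move=> Nz; apply: EFin_inj; rewrite -vE' vE//= -EFin_max -EFin_min.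
  by rewrite !vC// (le_trans (clamp_lip _ _))// vp.
Qed.

End space.

(** * Suprema of families of functions *)

Section suprema.
Context {R : realType} {P : pmetricType R}.
Local Open Scope ring_scope.

Definition supf (W : set (P -> R)) (x : P) : R := sup [set w x | w in W].

Variable W : set (P -> R).
Hypothesis W0 : W !=set0.
Hypothesis W01 : forall w x, W w -> 0 <= w x <= 1.

Let values_neq0 x : [set w x | w in W] !=set0.
Proof. by have [w Ww] := W0; exists (w x), w. Qed.

Lemma supf_ub w x : W w -> w x <= supf W x.
Proof.
move=> Ww; apply: ub_le_sup; last by exists w.
by exists 1 => _ [w' Ww' <-]; have /andP[] := W01 x Ww'.
Qed.

Lemma supf_le x b : (forall w, W w -> w x <= b) -> supf W x <= b.
Proof. by move=> Wb; apply: ge_sup => // _ [w Ww <-]; exact: Wb. Qed.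

Lemma supf_gt x a : (a < supf W x) <-> (exists2 w, W w & a < w x).
Proof.
split=> [/(sup_gt (values_neq0 x)) [_ [w Ww <-] aw]|[w Ww aw]]; first by exists w.
by rewrite (lt_le_trans aw)// supf_ub.
Qed.

Lemma supf01 x : 0 <= supf W x <= 1.
Proof.
have [w Ww] := W0; have /andP[w0 w1] := W01 x Ww.
rewrite (le_trans w0 (supf_ub _ Ww)) supf_le// => w' Ww'.
by have /andP[] := W01 x Ww'.
Qed.

Lemma supf_osc x y b : (forall w, W w -> `|w x - w y| <= b) ->
  `|supf W x - supf W y| <= b.
Proof.
move=> Wb.
have h1 : supf W y <= supf W x + b.
  apply: supf_le => w Ww; have := Wb w Ww; rewrite ler_norml => /andP[h _].
  have := supf_ub x Ww; lra.
have h2 : supf W x <= supf W y + b.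
  apply: supf_le => w Ww; have := Wb w Ww; rewrite ler_norml => /andP[_ h].
  have := supf_ub y Ww; lra.
by rewrite ler_norml; apply/andP; split; lra.
Qed.

End suprema.

(** * Capacity of unions and of points selected by balls *)

Section capacity_tools.
Context {R : realType} {P : pmetricType R}.
Variable mu : {outer_measure set P -> \bar R}.
Local Notation T := (caratheodory_type mu).
Hypothesis mu_regular : borel_regular mu.
Variables (X : qbfs mu) (s : R).
Hypotheses (s_gt0 : (0 < s)%R) (s_le1 : (s <= 1)%R).

Lemma measurable_superlevels (f : P -> R) :
  (forall a : R, measurable ([set x | (a < f x)%R] : set T)) ->
  mu_measurable mu (EFin \o f).
Proof.
move=> H; apply/measurable_EFinP.
apply: (measurability _ (RGenOInfty.measurableE R)) => //.
move=> _ [_ [a ->] <-]; rewrite setTI.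
suff -> : f @^-1` `]a, +oo[%classic = [set x | (a < f x)%R] by exact: H.
by apply/seteqP; split => x /=; rewrite in_itv /= andbT.
Qed.

(** The supremum of the test functions tests the union; it is bounded by the
    series of the test functions, and the series of the gradients is a
    gradient of it. *)
Lemma capacity_bigcup (e : R) : (0 < e)%R ->
  exists2 del : nat -> R, forall k, (0 < del k)%R &
  forall F : nat -> set P, (forall k, capacity X s (F k) < (del k)%:E) ->
    capacity X s (\bigcup_k F k) <= e%:E.
Proof.
move=> e0; have [K K1 HK] := quasi_triangle X.
have K0 : (0 < 2 * K)%R by rewrite mulr_gt0// (lt_le_trans _ K1).
have e2 : (0 < e / 2)%R by rewrite divr_gt0.
pose del k := (e / 2 / (2 * K) ^+ k.+1)%R.
exists del => [k|F capF]; first by rewrite divr_gt0// exprn_gt0.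
have H k := @capacity_test _ _ _ X s s_gt0 (F k) (del k) (capF k).
have [v Hv] := choice H; have [p Hp] := choice Hv.
have [U HU] := choice Hp; have [N HN] := choice HU.
have v01 k x : (0 <= v k x <= 1)%R by have [_ [_ _ _ ->]] := HN k.
have p0 k x : (0 <= p k x)%R by have [_ [_ _ _ _ []]] := HN k.
have [Fv [Nv [XFv nFv Nv0 _ Fvub]]] : exists F N, [/\ inX X F, (nX X F <= e / 2)%R,
   mu N = 0, forall x, (0 <= F x)%R & forall k x, ~ N x -> (v k x <= F x)%R].
  apply: (quasi_series e2 K1 HK) => [k x|k]; first by have /andP[] := v01 k x.
  by have [[? _ /ltW ? _] _] := HN k.
have [Fp [Np [XFp nFp Np0 Fp0 Fpub]]] : exists F N, [/\ inX X F, (nX X F <= e / 2)%R,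
   mu N = 0, forall x, (0 <= F x)%R & forall k x, ~ N x -> (p k x <= F x)%R].
  apply: (quasi_series e2 K1 HK) => [//|k].
  by have [[_ ? _ /ltW ?] _] := HN k.
pose W : set (P -> R) := range v.
have W0 : W !=set0 by exists (v 0%N), 0%N.
have W01 w x : W w -> (0 <= w x <= 1)%R by move=> [k _ <-].
have mW : mu_measurable mu (EFin \o supf W).
  apply: measurable_superlevels => a.
  have -> : [set x | (a < supf W x)%R] = \bigcup_k [set x | (a < v k x)%R].
    apply/seteqP; split => x /=.
      by move=> /(supf_gt W0 W01) [_ [k _ <-] ?]; exists k.
    by move=> [k _ /= ?]; apply/(supf_gt W0 W01); exists (v k) => //; exists k.
  apply: bigcupT_measurable => k.
  have [[Xv _ _ _] _] := HN k.
  have /measurable_EFinP mv := inX_measurable Xv.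
  have := mv measurableT `]a, +oo[%classic (measurable_itv _).
  rewrite setTI; congr measurable.
  by apply/seteqP; split => x /=; rewrite in_itv /= andbT.
have [XW nW] : inX X (supf W) /\ (nX X (supf W) <= nX X Fv)%R.
  apply: (inX_le XFv mW Nv0) => x Nx; have /andP[S0 _] := supf01 W0 W01 x.
  rewrite ger0_norm// (le_trans _ (ler_norm _))//.
  by apply: supf_le => // _ [k _ <-]; exact: Fvub.
have N0 : mu (Np `|` \bigcup_k N k) = 0.
  apply: negligible_null; apply: negligibleU; first exact: null_negligible.
  apply: negligible_bigcup => k; apply: null_negligible.
  by have [_ [_ _ _ _ []]] := HN k.
have gW : hgrad mu s (supf W) Fp (Np `|` \bigcup_k N k).
  split => // x y /not_orP[px Nx] /not_orP[py Ny].
  apply: supf_osc => // _ [k _ <-].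
  have [_ [_ _ _ _ [_ _ vg]]] := HN k.
  apply: (le_trans (vg _ _ _ _)).
  - by move=> Nkx; apply: Nx; exists k.
  - by move=> Nky; apply: Ny; exists k.
  - by apply: ler_wpM2l; [exact: powR_ge0|rewrite lerD// Fpub].
have oU : open (\bigcup_k U k).
  by apply: bigcup_open => k _; have [_ []] := HN k.
apply: (le_trans (capacity_le XW XFp gW oU _ _)).
- by move=> x [k _ Fx]; exists k => //; have [_ [_ FU _ _ _]] := HN k; exact: FU.
- move=> x [k _ Ux]; have [_ [_ _ vU _ _]] := HN k.
  by rewrite -(vU _ Ux); apply: supf_ub => //; exists k.
- rewrite lee_fin; lra.
Qed.

Definition bump (z : P) (r : R) (x : P) : R := clamp (2 - 2 * (mdist z x / r))%R.

Lemma clamp01 (a : R) : (0 <= clamp a <= 1)%R.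
Proof. by rewrite /clamp le_min ge_min le_max !lexx ler01. Qed.

Lemma bump_eq0 (z : P) (r : R) x : (0 < r)%R -> (r <= mdist z x)%R -> bump z r x = 0%R.
Proof.
move=> r0 rx; rewrite /bump /clamp (max_idPl _).
  by apply/min_idPr.
by rewrite subr_le0 ler_peMr// ler_pdivlMr// mul1r.
Qed.

Lemma bump_eq1 (z : P) (r : R) x : (0 < r)%R -> (mdist z x < r / 2)%R ->
  bump z r x = 1%R.
Proof.
move=> r0 rx; have h : (mdist z x / r <= 2^-1)%R.
  by rewrite ler_pdivrMr// mulrC ltW.
rewrite /bump /clamp; apply/min_idPl; rewrite le_max; apply/orP; right; lra.
Qed.

Lemma bump_lip (z : P) (r : R) x y : (0 < r)%R ->
  (`|bump z r x - bump z r y| <= 2 * (mdist x y / r))%R.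
Proof.
move=> r0; apply: (le_trans (clamp_lip _ _)).
have -> : (2 - 2 * (mdist z x / r) - (2 - 2 * (mdist z y / r)) =
    2 * ((mdist z y - mdist z x) / r))%R by ring.
rewrite normrM ger0_norm// ler_pM2l// normrM (gtr0_norm (x := r^-1)) ?invr_gt0//.
rewrite ler_pM2r ?invr_gt0// ler_norml.
have := metric_triangle z x y; have := metric_triangle z y x.
by rewrite (metric_sym y x) => *; apply/andP; split; lra.
Qed.

(** Both the Lipschitz bound and the bound by the height are needed: their
    minimum is at most a multiple of the [s]-th power of [mdist x y / r]. *)
Lemma bump_holder (z : P) (r : R) x y : (0 < r)%R ->
  (`|bump z r x - bump z r y| <= powR (mdist x y) s * (2 * powR r (- s)))%R.
Proof.
move=> r0; set t := (mdist x y / r)%R.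
have t0 : (0 <= t)%R by rewrite divr_ge0 ?mdist_ge0 ?ltW.
have -> : (powR (mdist x y) s * (2 * powR r (- s)) = 2 * powR t s)%R.
  rewrite /t powRM ?mdist_ge0 ?invr_ge0 ?(ltW r0)//.
  by rewrite -(powR_inv1 (ltW r0)) -powRrM mulN1r; ring.
have [t1|t1] := leP t 1%R.
  apply: (le_trans (bump_lip z x y r0)); rewrite ler_pM2l//.
  have [tE|tn0] := eqVneq t 0%R; first by rewrite [leLHS]tE powR_ge0.
  by rewrite ger1_powR// lt_neqAle eq_sym tn0 t0.
have p1 : (1 <= powR t s)%R.
  rewrite -[leLHS](congr1 (fun f => f s) (powR1 R)).
  by apply: ge0_ler_powR; rewrite ?nnegrE ?(ltW s_gt0) ?(ltW t1).
have := clamp01 (2 - 2 * (mdist z x / r)); have := clamp01 (2 - 2 * (mdist z y / r)).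
rewrite -/(bump z r x) -/(bump z r y) => /andP[? ?] /andP[? ?].
by rewrite ler_norml; apply/andP; split; lra.
Qed.

Lemma bump_open (z : P) (r a : R) : (0 < r)%R -> open [set x | (a < bump z r x)%R].
Proof.
move=> r0; rewrite openE => x /= ax; rewrite /interior; apply/nbhs_ballP.
exists ((bump z r x - a) / 2 * r)%R => /=.
  by rewrite mulr_gt0// divr_gt0// subr_gt0.
move=> y; rewrite ballEmdist /= -ltr_pdivrMr// => xy.
have := bump_lip z x y r0; rewrite ler_norml => /andP[_ h] /=; lra.
Qed.

Lemma maxr_lip (a b a' b' : R) :
  (`|Num.max a b - Num.max a' b'| <= `|a - a'| + `|b - b'|)%R.
Proof.
have := ler_norm (a - a')%R; have := ler_norm (a' - a)%R.
have := ler_norm (b - b')%R; have := ler_norm (b' - b)%R.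
rewrite (distrC a' a) (distrC b' b) ler_norml /Num.max.
by have [ab|ab] := ltP a b; have [ab'|ab'] := ltP a' b' => *;
  apply/andP; split; lra.
Qed.

(** Where [v] is at least one half, a bump is invisible below [min 1 (2 * v)];
    elsewhere in its ball [G] dominates its slope. So the supremum of
    [min 1 (2 * v)] and all the bumps has a gradient comparable to [h + G],
    with the same null set for every ball, however many balls there are. The
    same dichotomy bounds the supremum by [2 * v + G]. *)
Lemma capacity_bumps (K : R) (v h G : P -> R) (N U : set P) (B : P -> R -> Prop) :
  (1 <= K)%R ->
  (forall f g, inX X f -> inX X g ->
     (nX X (fun x => f x + g x) <= K * (nX X f + nX X g))%R) ->
  inX X v -> inX X h -> inX X G -> hgrad mu s v h N -> (forall x, (0 <= G x)%R) ->
  (forall x, (0 <= v x <= 1)%R) -> open U -> (forall x, U x -> v x = 1%R) ->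
  (forall z r, B z r -> (0 < r <= 1)%R /\
     forall x, ~ N x -> (mdist z x < r)%R -> (v x < 2^-1)%R ->
     (powR r (- s) <= G x)%R) ->
  capacity X s (U `|` [set z | exists r, B z r])
    <= (4 * K * (nX X v + nX X h + nX X G))%:E.
Proof.
move=> K1 HK Xv Xh XG [N0 h0 vh] G0 v01 oU vU BG.
pose v' x : R := Num.min 1%R (2 * v x)%R.
have v'01 x : (0 <= v' x <= 1)%R.
  have /andP[v0 v1] := v01 x.
  by rewrite /v' le_min ge_min lexx ler01 mulr_ge0.
have v'1 x : (2^-1 <= v x)%R -> v' x = 1%R.
  by move=> vx; apply/min_idPl; lra.
have v'h x y : ~ N x -> ~ N y ->
    (`|v' x - v' y| <= powR (mdist x y) s * (2 * h x + 2 * h y))%R.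
  move=> Nx Ny; have /andP[vx0 _] := v01 x; have /andP[vy0 _] := v01 y.
  have v'E z : v' z = clamp (2 * v z)%R.
    have /andP[vz0 _] := v01 z.
    by rewrite /v' /clamp (max_idPr _)// mulr_ge0.
  rewrite !v'E; apply: (le_trans (clamp_lip _ _)); rewrite -mulrBr normrM ger0_norm//.
  by have := vh x y Nx Ny; lra.
pose w z r x : R := Num.max (v' x) (bump z r x).
pose W : set (P -> R) := [set f | f = v' \/ exists z r, B z r /\ f = w z r].
have W0 : W !=set0 by exists v'; left.
have W01 f x : W f -> (0 <= f x <= 1)%R.
  move=> [->//|[z [r [_ ->]]]]; have /andP[? ?] := v'01 x.
  have /andP[? ?] := clamp01 (2 - 2 * (mdist z x / r)).
  by rewrite /w le_max ge_max; apply/andP; split; apply/andP || apply/orP; [left|split].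
(* At each point the bump either is invisible or has its slope below [G]. *)
have wE z r x : B z r -> ~ N x -> w z r x = v' x \/ (powR r (- s) <= G x)%R.
  move=> Bzr Nx; have [/andP[r0 r1] H] := BG _ _ Bzr.
  have [vx|vx] := leP (2^-1)%R (v x).
    left; rewrite /w v'1//; apply/max_idPl.
    by have /andP[] := clamp01 (2 - 2 * (mdist z x / r)).
  have [zx|zx] := ltP (mdist z x) r; first by right; exact: H.
  left; rewrite /w bump_eq0//; apply/max_idPl.
  by have /andP[] := v'01 x.
have p0 x y : (0 <= powR (mdist x y) s)%R by exact: powR_ge0.
have gW : hgrad mu s (supf W) (fun x => 2 * (h x + G x))%R N.
  split => // [x|x y Nx Ny]; first by rewrite mulr_ge0// addr_ge0.
  apply: supf_osc => // f Wf.
  have base : (powR (mdist x y) s * (2 * h x + 2 * h y) <=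
      powR (mdist x y) s * (2 * (h x + G x) + 2 * (h y + G y)))%R.
    by apply: ler_wpM2l => //; have := G0 x; have := G0 y; lra.
  case: Wf => [->|[z [r [Bzr ->]]]]; first exact: (le_trans (v'h _ _ Nx Ny)).
  have [/andP[r0 r1] _] := BG _ _ Bzr.
  have far b : (powR r (- s) <= b)%R -> (b <= G x + G y)%R ->
      (`|w z r x - w z r y| <=
        powR (mdist x y) s * (2 * (h x + G x) + 2 * (h y + G y)))%R.
    move=> rb bG; apply: (le_trans (maxr_lip _ _ _ _)).
    apply: (@le_trans _ _ (powR (mdist x y) s * (2 * h x + 2 * h y) +
      powR (mdist x y) s * (2 * powR r (- s))))%R.
      by apply: lerD; [exact: v'h|exact: bump_holder].
    by rewrite -mulrDr; apply: ler_wpM2l => //; lra.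
  have := G0 x; have := G0 y => Gy Gx.
  have [Ex|Ex] := wE _ _ _ Bzr Nx; last by apply: (far _ Ex); lra.
  have [Ey|Ey] := wE _ _ _ Bzr Ny; last by apply: (far _ Ey); lra.
  by rewrite Ex Ey; exact: (le_trans (v'h _ _ Nx Ny)).
have mv' : mu_measurable mu (EFin \o v').
  have -> : EFin \o v' = fun x => mine 1 (2%:E * (EFin \o v) x).
    by apply/funext => x; rewrite /= EFin_min EFinM.
  apply: measurable_mine => //; apply: measurable_funeM.
  exact: (inX_measurable Xv).
have mW : mu_measurable mu (EFin \o supf W).
  apply: measurable_superlevels => a.
  have -> : [set x | (a < supf W x)%R] = [set x | (a < v' x)%R] `|`
      \bigcup_(i in [set i : P * R | B i.1 i.2]) [set x | (a < bump i.1 i.2 x)%R].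
    apply/seteqP; split => x /=.
      move=> /(supf_gt W0 W01) [_ [->|[z [r [Bzr ->]]]]]; first by left.
      rewrite /w lt_max => /orP[|] aw; first by left.
      by right; exists (z, r).
    move=> [av|[[z r] /= Bzr aw]]; apply/(supf_gt W0 W01).
      by exists v' => //; left.
    exists (w z r); first by right; exists z, r.
    by rewrite /w lt_max aw orbT.
  apply: measurableU.
    have /measurable_EFinP mv'' := mv'.
    have := mv'' measurableT `]a, +oo[%classic (measurable_itv _).
    rewrite setTI; congr measurable.
    by apply/seteqP; split => x /=; rewrite in_itv /= andbT.
  apply: open_caratheodory => //; apply: bigcup_open => -[z r] /= Bzr.
  by apply: bump_open; have [/andP[]] := BG _ _ Bzr.
have [X2v n2v] := inXZ Xv (ler0n R 2).
have X2vG := inXD X2v XG.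
have [XW nW] : inX X (supf W) /\ (nX X (supf W) <= nX X (fun x => 2 * v x + G x))%R.
  apply: (inX_le X2vG mW N0) => x Nx; have /andP[S0 _] := supf01 W0 W01 x.
  rewrite ger0_norm// (le_trans _ (ler_norm _))//.
  have v'le : (v' x <= 2 * v x)%R by rewrite /v' ge_min lexx orbT.
  have Gx := G0 x; apply: supf_le => // _ [->|[z [r [Bzr ->]]]]; first lra.
  have [->|rG] := wE _ _ _ Bzr Nx; first lra.
  have [/andP[r0 r1] _] := BG _ _ Bzr.
  have r1s : (1 <= powR r (- s))%R.
    rewrite powRN invf_ge1 ?powR_gt0//.
    rewrite -[leRHS](congr1 (fun f => f s) (powR1 R)).
    by apply: ge0_ler_powR; rewrite ?nnegrE ?(ltW s_gt0) ?(ltW r0).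
  have /andP[vx0 _] := v01 x.
  have /andP[_ ?] := W01 (w z r) x (or_intror (ex_intro _ z (ex_intro _ r (conj Bzr erefl)))).
  lra.
have XhG := inXD Xh XG.
have [X2hG n2hG] := inXZ XhG (ler0n R 2).
pose O := U `|` \bigcup_(i in [set i : P * R | B i.1 i.2]) ball i.1 (i.2 / 2)%R.
have oO : open O.
  by apply: openU => //; apply: bigcup_open => i _; exact: metric_ball_open.
apply: (le_trans (capacity_le XW X2hG gW oO _ _)).
- move=> z [Uz|[r Bzr]]; first by left.
  right; exists (z, r) => //=; rewrite ballEmdist /= mdistxx divr_gt0//.
  by have [/andP[]] := BG _ _ Bzr.
- move=> x [Ux|[[z r] /= Bzr]].
    rewrite (le_trans _ (supf_ub W01 _ (or_introl erefl)))// v'1// vU//.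
    by rewrite invf_le1// ler1n.
  have [/andP[r0 _] _] := BG _ _ Bzr.
  rewrite ballEmdist /= => zx.
  have Ww : W (w z r) by right; exists z, r.
  by rewrite (le_trans _ (supf_ub W01 _ Ww))// /w le_max bump_eq1// lexx orbT.
rewrite lee_fin n2hG.
have := HK _ _ X2v XG; rewrite n2v => h1; have h2 := HK _ _ Xh XG.
have nv0 := nX_ge0 Xv; have nh0 := nX_ge0 Xh; have nG0 := nX_ge0 XG.
have : (0 <= K * nX X v)%R by rewrite mulr_ge0// (le_trans ler01).
have : (0 <= K * nX X h)%R by rewrite mulr_ge0// (le_trans ler01).
have : (0 <= K * nX X G)%R by rewrite mulr_ge0// (le_trans ler01).
lra.
Qed.

End capacity_tools.

(** * Points with concentrated exceptional set or gradient *)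

Section bad_points.
Context {R : realType} {P : pmetricType R}.
Variable mu : {outer_measure set P -> \bar R}.
Local Notation T := (caratheodory_type mu).
Hypothesis mu_regular : borel_regular mu.
Hypothesis mu_balls : balls_pos_finite mu.
Variable cd : R.
Hypothesis cd_gt0 : (0 < cd)%R.
Hypothesis mu_double : forall (x : P) (r : R), (0 < r)%R ->
  mu (ball x (2 * r)%R) <= cd%:E * mu (ball x r).

Lemma maximal_ge (F : P -> \bar R) (x z : P) (r tau : R) :
  (forall y, 0 <= F y) -> mu_measurable mu F ->
  (0 < r)%R -> (r < 2^-1)%R -> (mdist z x < r)%R -> (0 <= tau)%R ->
  tau%:E * mu (ball z r) <= \int[cmeas mu]_(y in ball z r) F y ->
  (tau / (cd * cd))%:E <= maximal mu 1 F x.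
Proof.
move=> F0 mF r0 r12 zx tau0 H.
have r20 : (0 < 2 * r)%R by rewrite mulr_gt0.
have r40 : (0 < 2 * (2 * r))%R by rewrite mulr_gt0.
apply: (@le_trans _ _ (mavg mu (fun y => `|F y|) (ball x (2 * r)))); last first.
  by apply: ereal_sup_ubound; exists (2 * r)%R => //=; apply/andP; split; lra.
rewrite /mavg; have -> : \int[cmeas mu]_(y in ball x (2 * r)) `|F y| =
    \int[cmeas mu]_(y in ball x (2 * r)) F y.
  by apply: eq_integral => y _; rewrite gee0_abs.
have [m m0 Em] := ball_fin mu_balls z r0.
have [m2 m20 Em2] := ball_fin mu_balls x r20.
have m2m : (m2 <= cd * cd * m)%R.
  rewrite -lee_fin -Em2 -mulrA EFinM EFinM -Em.
  apply: (@le_trans _ _ (mu (ball z (2 * (2 * r))))).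
    apply: le_outer_measure => y; rewrite !ballEmdist /= => xy.
    by have := metric_triangle z x y; lra.
  apply: (le_trans (mu_double z r20)).
  by rewrite lee_wpmul2l ?lee_fin ?(ltW cd_gt0)// mu_double.
rewrite Em2 inver gt_eqF// lee_pdivlMl//.
apply: (@le_trans _ _ (\int[cmeas mu]_(y in ball z r) F y)); last first.
  apply: ge0_subset_integral => //; try exact: ball_caratheodory.
  - exact: measurable_funTS.
  - move=> y; rewrite !ballEmdist /= => zy.
    by have := metric_triangle x z y; rewrite (metric_sym x z); lra.
apply: le_trans H; rewrite Em -!EFinM lee_fin mulrA ler_pdivrMr ?mulr_gt0//.
by have := ler_wpM2r tau0 m2m; lra.
Qed.

Lemma root_maximal_ge (F : P -> \bar R) (x z : P) (r q a : R) :
  (0 < q)%R -> (forall y, 0 <= F y) -> mu_measurable mu F ->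
  (0 < r)%R -> (r < 2^-1)%R -> (mdist z x < r)%R -> (0 <= a)%R ->
  (powR a q / 2)%:E * mu (ball z r) <=
    \int[cmeas mu]_(y in ball z r) poweR (F y) q ->
  (a / powR (2 * (cd * cd)) q^-1)%:E <=
    poweR (maximal mu 1 (fun y => poweR (F y) q) x) q^-1.
Proof.
move=> q0 F0 mF r0 r12 zx a0 H.
have cd2 : (0 < cd * cd)%R by rewrite mulr_gt0.
have := maximal_ge _ _ r0 r12 zx _ H.
have mFq : mu_measurable mu (fun y => poweR (F y) q).
  exact: (measurableT_comp (measurable_poweR _) mF).
rewrite divr_ge0 ?powR_ge0// => /(_ (fun y => poweR_ge0 _ _) mFq isT) M.
set t := (powR a q / 2 / (cd * cd))%R in M.
have t0 : (0 <= t)%R by rewrite !divr_ge0 ?powR_ge0// ltW.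
have -> : (a / powR (2 * (cd * cd)) q^-1)%:E = poweR t%:E q^-1.
  rewrite poweR_EFin; congr EFin.
  have -> : (t = powR a q * (2 * (cd * cd))^-1)%R.
    by rewrite /t; field; rewrite gt_eqF.
  rewrite [RHS]powRM ?powR_ge0 ?invr_ge0 ?mulr_ge0 ?(ltW cd_gt0)//.
  rewrite -powRrM mulfV ?gt_eqF// powRr1//; congr (_ * _)%R.
  have D0 : (0 < 2 * (cd * cd))%R by rewrite mulr_gt0.
  by rewrite -(powR_inv1 (ltW D0)) -powRrM mulN1r powRN.
apply: gt0_ler_poweR; rewrite ?invr_ge0 ?(ltW q0)// in_itv /= ?lee_fin ?t0 ?leey//.
by rewrite (le_trans _ M)// lee_fin.
Qed.

Variables (s q : R).
Hypotheses (s_gt0 : (0 < s)%R) (s_le1 : (s <= 1)%R) (q_gt0 : (0 < q)%R).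
Variable X : qbfs mu.
Hypothesis X_maximal : forall (x : P) (r : R), (0 < r)%R -> exists C : R,
  forall g : P -> \bar R, qcarrier X g -> (forall y, 0 <= g y) ->
    xnorm X (mulchi
      (fun y => poweR (maximal mu 1 (fun z => poweR (g z) q) y) q^-1)
      (ball x r)) <= C%:E * xnorm X g.

(** Both alternatives make [p] or the maximal function of [p `^ q] large: the
    second at every point of the ball, the first at the points where the test
    function of [U] is small. *)
Definition bad_ball (U : set P) (p : P -> R) (z : P) (r : R) :=
  [/\ (0 < r)%R, (r < 2^-1)%R &
    (2^-1)%:E * mu (ball z r) <= mu (U `&` ball z r) \/
    (powR (powR r (- s)) q)%:E * mu (ball z r) <=
      \int[cmeas mu]_(y in ball z r) (powR (p y) q)%:E].

(** In the first alternative the gradient inequality between [x] and the points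
    of [U] forces either [p x] or [p] at almost all points of [U `&` ball z r]
    to be at least one eighth of [r `^ (- s)]. *)
Lemma bad_ball_slope (v p : P -> R) (U N : set P) (z x : P) (r : R) :
  mu_measurable mu (EFin \o p) -> hgrad mu s v p N ->
  (forall y, U y -> v y = 1%R) -> bad_ball U p z r ->
  ~ N x -> (mdist z x < r)%R -> (0 <= v x)%R -> (v x < 2^-1)%R ->
  (powR r (- s) <= 8 * p x)%R \/
  (powR r (- s) / 8 / powR (2 * (cd * cd)) q^-1)%:E <=
    poweR (maximal mu 1 (fun y => poweR ((EFin \o p) y) q) x) q^-1.
Proof.
move=> mp [N0 p0 vp] vU [rr0 r12 bad] Nx zx vx0 vx.
set a := (powR r (- s) / 8)%R.
have a0 : (0 < a)%R by rewrite divr_gt0 ?powR_gt0.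
have r8 : powR r (- s) = (8 * a)%R by rewrite /a; field.
have [apx|pxa] := leP a (p x); first by left; rewrite r8 ler_pM2l.
have Ep0 y : 0 <= (EFin \o p) y by rewrite lee_fin.
right; apply: (root_maximal_ge q_gt0 Ep0 mp rr0 r12 zx (ltW a0)).
case: bad => [dense|frac].
  rewrite EFinM -muleA.
  apply: (@le_trans _ _ ((powR a q)%:E * mu (U `&` ball z r))).
    by rewrite lee_wpmul2l ?lee_fin ?powR_ge0.
  apply: (chebyshev_outer (N := N)) => //.
  - exact: ball_caratheodory.
  - by apply: measurable_funTS; exact: (measurableT_comp (measurable_poweR _) mp).
  - by move=> y; exact: poweR_ge0.
  - exact: powR_ge0.
  move=> y [Uy zy] Ny; rewrite poweR_EFin lee_fin.
  apply: ge0_ler_powR; rewrite ?nnegrE ?(ltW q_gt0) ?(ltW a0)//.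
  rewrite ballEmdist /= in zy.
  have := vp y x Ny Nx; rewrite vU// => h.
  have d1 : (2^-1 <= powR (mdist y x) s * (p y + p x))%R.
    by apply: le_trans h; rewrite ger0_norm; lra.
  have d2 : (powR (mdist y x) s <= 2 * powR r s)%R.
    apply: (@le_trans _ _ (powR (2 * r) s)).
      apply: ge0_ler_powR;
        rewrite ?nnegrE ?mdist_ge0 ?mulr_ge0 ?(ltW s_gt0) ?(ltW rr0)//.
      have := metric_triangle y z x; rewrite (metric_sym y z); lra.
    by rewrite powRM ?(ltW rr0)// ler_pM2r ?powR_gt0// ler1_powR// ler1n.
  have d3 : (powR (mdist y x) s * (p y + p x) <= 2 * powR r s * (p y + p x))%R.
    by apply: ler_wpM2r => //; rewrite addr_ge0.
  have rs0 : (0 < powR r s)%R by rewrite powR_gt0.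
  have aE : (a = (powR r s)^-1 / 8)%R by rewrite /a powRN.
  have d4 : ((powR r s)^-1 / 4 <= p y + p x)%R.
    rewrite ler_pdivrMr// -(ler_pM2l rs0) mulfV ?gt_eqF//; lra.
  lra.
apply: le_trans frac; rewrite lee_wpmul2r ?outer_measure_ge0// lee_fin.
have aq : (powR a q <= powR (powR r (- s)) q)%R.
  apply: ge0_ler_powR; rewrite ?nnegrE ?powR_ge0 ?(ltW q_gt0) ?(ltW a0)//.
  rewrite r8; lra.
have := powR_ge0 a q; lra.
Qed.

(** The maximal function is controlled only on bounded sets, which is why the
    bad centres are restricted to [ball x0 r0]; the radii are below one half, so
    the bumps live in [ball x0 (r0 + 1)]. *)
Lemma capacity_bad (x0 : P) (r0 : R) : (0 < r0)%R -> exists2 C : R, (0 <= C)%R &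
  forall (v p : P -> R) (U N : set P), inX X v -> inX X p -> hgrad mu s v p N ->
  (forall x, (0 <= v x <= 1)%R) -> open U -> (forall x, U x -> v x = 1%R) ->
  capacity X s (U `|` [set z | exists r, ball x0 r0 z /\ bad_ball U p z r])
    <= (C * (nX X v + nX X p))%:E.
Proof.
move=> r00.
have r01 : (0 < r0 + 1)%R by rewrite addr_gt0.
have [C0 HC] := X_maximal x0 r01.
have [K K1 HK] := quasi_triangle X.
have cd2 : (0 < 2 * (cd * cd))%R by rewrite !mulr_gt0.
pose K1' : R := (8 * powR (2 * (cd * cd)) q^-1)%R.
have K1'0 : (0 <= K1')%R by rewrite mulr_ge0// powR_ge0.
pose C := (4 * K * (1 + K * (8 + K1' * `|C0|)))%R.
have KK0 : (0 <= K)%R by rewrite (le_trans ler01).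
have C00 : (0 <= C)%R.
  apply: mulr_ge0; first by rewrite mulr_ge0.
  by apply: addr_ge0 => //; apply: mulr_ge0 => //; rewrite addr_ge0// mulr_ge0.
exists C => // v p U N Xv Xp [N0 p0 vp] v01 oU vU.
pose F := mulchi (fun y => poweR (maximal mu 1
  (fun z => poweR ((EFin \o p) z) q) y) q^-1) (ball x0 (r0 + 1)).
have Ep0 y : 0 <= (EFin \o p) y by rewrite lee_fin.
have mp := inX_measurable Xp.
have F0 y : 0 <= F y by rewrite /F /mulchi mule_ge0 ?poweR_ge0 ?lee_fin.
have XF : xnorm X F <= (`|C0| * nX X p)%:E.
  apply: (le_trans (HC _ Xp Ep0)); rewrite xnormE// -EFinM lee_fin.
  by apply: ler_wpM2r; [exact: nX_ge0|exact: ler_norm].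
have [XF' nF] := extnorm_le XF.
have [XH nH [N2 N20 FE]] := fine_inX XF' F0.
have [X8p n8p] := inXZ Xp (ler0n R 8).
have [XKH nKH] := inXZ XH K1'0.
have XG := inXD X8p XKH; have nG := HK _ _ X8p XKH.
have H0 y : (0 <= (fine \o F) y)%R by exact: fine_ge0.
have hg : hgrad mu s v p (N `|` N2).
  split => //.
    by apply/eqP; rewrite eq_le outer_measure_ge0 andbT
      (le_trans (outer_measureU2 mu _ _))// N0 N20 adde0.
  by move=> x y /not_orP[? _] /not_orP[? _]; exact: vp.
apply: (le_trans (capacity_bumps mu_regular s_gt0 s_le1
  (B := fun z r => ball x0 r0 z /\ bad_ball U p z r) K1 HK Xv Xp XG hg _ v01 oU vU _)).
- by move=> x; apply: addr_ge0; [exact: mulr_ge0|exact: (mulr_ge0 K1'0 (H0 x))].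
- move=> z r [x0z bad]; split.
    by have [rr0 r12 _] := bad; rewrite rr0; lra.
  move=> x /not_orP[Nx N2x] zx vx.
  have /andP[vx0 _] := v01 x.
  have Hx0 := H0 x; have px0 := p0 x.
  have [h|] := bad_ball_slope mp (And3 N0 p0 vp) vU bad Nx zx vx0 vx.
    by have := mulr_ge0 K1'0 Hx0; lra.
  have Bx : ball x0 (r0 + 1) x.
    have [_ r12 _] := bad; move: x0z; rewrite !ballEmdist /= => x0z.
    by have := metric_triangle x0 z x; lra.
  have -> : poweR (maximal mu 1 (fun y => poweR ((EFin \o p) y) q) x) q^-1 = F x.
    by rewrite /F /mulchi indicE mem_set// mule1.
  rewrite FE// lee_fin ler_pdivrMr ?powR_gt0// ler_pdivrMr// => h.
  apply: (ler_wpDl (mulr_ge0 (ler0n R 8) px0)); apply: (le_trans h).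
  by rewrite le_eqVlt; apply/orP; left; apply/eqP; rewrite /K1' /=; ring.
rewrite lee_fin.
have nv := nX_ge0 Xv; have np := nX_ge0 Xp.
apply: (@le_trans _ _ (4 * K * (nX X v + nX X p +
   K * (8 * nX X p + K1' * (`|C0| * nX X p))))%R).
  apply: ler_wpM2l; first by rewrite mulr_ge0.
  rewrite lerD2l (le_trans nG)// n8p nKH; apply: ler_wpM2l => //.
  rewrite lerD2l; apply: ler_wpM2l => //; exact: (le_trans nH).
have k1 : (0 <= K * (8 + K1' * `|C0|) * nX X v)%R.
  by rewrite !mulr_ge0// addr_ge0// mulr_ge0.
rewrite /C -!mulrA ler_pM2l// ler_wpM2l//; move: k1; rewrite -!mulrA.
lra.
Qed.

End bad_points.

(** * Averages over balls and Lebesgue points *)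

Section means.
Context {R : realType} {P : pmetricType R}.
Variable mu : {outer_measure set P -> \bar R}.
Local Notation T := (caratheodory_type mu).
Hypothesis mu_regular : borel_regular mu.
Hypothesis mu_balls : balls_pos_finite mu.
Variable cd : R.
Hypothesis cd_gt0 : (0 < cd)%R.
Hypothesis mu_double : forall (x : P) (r : R), (0 < r)%R ->
  mu (ball x (2 * r)%R) <= cd%:E * mu (ball x r).
Variables (s c Q : R).
Hypotheses (s_gt0 : (0 < s)%R) (s_le1 : (s <= 1)%R).
Hypotheses (c_gt0 : (0 < c)%R) (Q_gt0 : (0 < Q)%R).
Hypothesis mu_lower : forall (x y : P) (r rho : R),
  (0 < r)%R -> (r <= rho)%R -> ball x rho y ->
  (c * powR (r / rho) Q)%:E <= mu (ball y r) * (mu (ball x rho))^-1.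
Local Notation q := (Q / (Q + s))%R.

(** The integral of [u] may be [+oo], so [u] itself need not be integrable. *)
Lemma integral_ae_lower (A : set P) (f u : P -> \bar R) (N : set P) :
  measurable (A : set T) -> (cmeas mu).-integrable (A : set T) (f : T -> _) ->
  mu_measurable mu u -> mu N = 0 -> (forall y, A y -> ~ N y -> f y <= u y) ->
  \int[cmeas mu]_(y in A) u^\- y < +oo /\
  \int[cmeas mu]_(y in A) f y <= \int[cmeas mu]_(y in A) u y.
Proof.
move=> mA intf mu_u N0 fu.
have mf := measurable_int _ intf.
have mu' : measurable_fun (A : set T) (u : T -> _) by exact: measurable_funTS.
have neg : \int[cmeas mu]_(y in A) u^\- y <= \int[cmeas mu]_(y in A) f^\- y.
  apply: ae_ge0_le_integral => //; try exact: measurable_funeneg.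
  apply: (ae_off_null N0) => y Ny Ay; rewrite !funenegE.
  by rewrite ge_max !le_max lexx leeN2 fu ?orbT.
have pos : \int[cmeas mu]_(y in A) f^\+ y <= \int[cmeas mu]_(y in A) u^\+ y.
  apply: ae_ge0_le_integral => //; try exact: measurable_funepos.
  apply: (ae_off_null N0) => y Ny Ay; rewrite !funeposE.
  by rewrite ge_max !le_max lexx fu ?orbT.
have fneg := integrable_neg_fin_num mA intf.
split; first by rewrite (le_lt_trans neg)// ltey_eq fneg.
by rewrite integralE [leRHS]integralE leeB.
Qed.

(** The first bound is what chaining needs; the second ensures that the
    superlevel set of the gradient fills at most half of a ball. *)
Definition scale_frac := (Num.min (chain_frac s c Q) (2 * cd)^-1)%R.

Lemma scale_frac_gt0 : (0 < scale_frac)%R.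
Proof.
by rewrite lt_min; apply/andP; split; [exact: chain_frac_gt0|rewrite invr_gt0 mulr_gt0].
Qed.

(** The set [E] fills less than half of the ball and, by the Chebyshev inequality,
    the superlevel set of [g] at [lam] at most half; a point outside both starts
    the chaining for [M - u]. *)
Lemma mean_lower (u : P -> \bar R) (g : P -> R) (N E : set P) (x : P)
    (r lam M : R) :
  mu_measurable mu u -> mu_measurable mu (EFin \o g) ->
  hgrad mu s (fine \o u) g N -> (forall y, ~ N y -> u y = (fine (u y))%:E) ->
  (0 < r)%R -> (0 < lam)%R ->
  \int[cmeas mu]_(y in ball x (2 * r)) (powR (g y) q)%:E
    <= (scale_frac * powR lam q)%:E * mu (ball x (2 * r)) ->
  mu (E `&` ball x r) < (2^-1)%:E * mu (ball x r) ->
  (forall z, ball x r z -> ~ E z -> M%:E <= u z) ->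
  \int[cmeas mu]_(y in ball x r) u^\- y < +oo /\
  (M - 2 * (chain_const q * (powR r s * lam)))%:E <= mavg mu u (ball x r).
Proof.
move=> mu_u mg [N0 g0 ug] uE r0 lam0 Ig dens uM.
have r20 : (0 < 2 * r)%R by rewrite mulr_gt0.
have lq0 : (0 < powR lam q)%R by rewrite powR_gt0.
have [m m0 Em] := ball_fin mu_balls x r0.
have [m2 m20 Em2] := ball_fin mu_balls x r20.
have m2m : (m2 <= cd * m)%R by rewrite -lee_fin EFinM -Em -Em2 mu_double.
have k0 := scale_frac_gt0.
have kcd : (scale_frac * cd <= 2^-1)%R.
  rewrite -ler_pdivlMr// -invfM; by rewrite ge_min lexx orbT.
have km : (scale_frac * m2 <= 2^-1 * m)%R.
  apply: (@le_trans _ _ (scale_frac * (cd * m))%R); first by rewrite ler_pM2l.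
  by rewrite mulrA ler_pM2r.
have mgq : mu_measurable mu (fun y => (powR (g y) q)%:E).
  exact: (measurableT_comp (measurable_poweR q) mg).
have gq0 y : 0 <= (powR (g y) q)%:E by rewrite lee_fin powR_ge0.
have mB : measurable (ball x r : set T) by exact: ball_caratheodory.
have mB2 : measurable (ball x (2 * r) : set T) by exact: ball_caratheodory.
have BB : ball x r `<=` ball x (2 * r) by move=> y; rewrite !ballEmdist /=; lra.
have [z [xz Nz gz uz]] : exists z, [/\ ball x r z, ~ N z, (g z <= lam)%R & M%:E <= u z].
  apply: contrapT => /forallNP none.
  have : (powR lam q)%:E * mu (ball x r `\` E) <=
      \int[cmeas mu]_(y in ball x (2 * r)) (powR (g y) q)%:E.
    apply: (chebyshev_outer (N := N)) => //.
    - exact: measurable_funTS.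
    - exact: powR_ge0.
    - by move=> y [/BB].
    - move=> y [xy Ey] Ny; rewrite lee_fin.
      apply: ge0_ler_powR; rewrite ?nnegrE ?(ltW lam0)//; first by rewrite divr_ge0 ?addr_ge0 ?ltW.
      by rewrite leNgt; apply/negP => /ltW gy; apply: (none y); split => //; exact: uM.
  move=> /le_trans /(_ Ig); rewrite Em2 -EFinM => cheb.
  have mD : mu (ball x r `\` E) <= (2^-1 * m)%:E.
    rewrite -(@lee_pmul2l _ (powR lam q)%:E) ?lte_fin//.
    by apply: (le_trans cheb); rewrite lee_fin mulrAC mulrC ler_pM2l.
  have : mu (ball x r) <= mu (E `&` ball x r) + mu (ball x r `\` E).
    by have := le_outer_measureIC mu E (ball x r); rewrite setIC.
  rewrite leNgt => /negP; apply; rewrite Em in dens *.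
  apply: (@lt_le_trans _ _ ((2^-1)%:E * m%:E + (2^-1 * m)%:E)).
    by apply: lte_leD => //; rewrite ge0_fin_numE ?outer_measure_ge0// (le_lt_trans mD)// ltry.
  by rewrite -EFinM -EFinD lee_fin; lra.
have Ig' : \int[cmeas mu]_(y in ball x (2 * r)) (powR (g y) q)%:E
    <= (chain_frac s c Q * powR lam q)%:E * mu (ball x (2 * r)).
  apply: (le_trans Ig); rewrite lee_wpmul2r ?outer_measure_ge0// lee_fin.
  by rewrite ler_pM2r//; rewrite ge_min lexx.
have vg y y' : ~ N y -> ~ N y' -> (M - fine (u y) <= M - fine (u y') +
    powR (mdist y y') s * (g y + g y'))%R.
  move=> Ny Ny'; have := ug _ _ Ny Ny'; rewrite ler_norml => /andP[] /=; lra.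
have ptw := pointwise_bound mu_regular mu_balls s_gt0 s_le1 c_gt0 Q_gt0 mu_lower
  r0 lam0 N0 g0 mg vg Ig'.
have zz : exists z, [/\ ball x r z, ~ N z, (g z <= lam)%R & (M - fine (u z) <= 0)%R].
  by exists z; split => //; rewrite subr_le0 -lee_fin -uE.
have {}ptw := ptw zz.
set A := (chain_const q * (powR r s * lam))%R.
have A0 : (0 <= A)%R.
  by rewrite !mulr_ge0 ?powR_ge0 ?(ltW lam0)// chain_const_ge0// divr_gt0 ?addr_gt0.
pose L := powR lam^-1 q.
have L0 : (0 <= L)%R by exact: powR_ge0.
have lamL : (powR lam q * L = 1)%R.
  by rewrite -powRM ?invr_ge0 ?(ltW lam0)// mulfV ?gt_eqF// (congr1 (fun f => f q) (powR1 R)).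
pose w y := (2 * A * L * powR (g y) q)%R.
have AL0 : (0 <= 2 * A * L)%R by apply: mulr_ge0 => //; exact: mulr_ge0.
have IB : \int[cmeas mu]_(y in ball x r) (powR (g y) q)%:E <=
    (scale_frac * powR lam q * m2)%:E.
  apply: (@le_trans _ _ (\int[cmeas mu]_(y in ball x (2 * r)) (powR (g y) q)%:E)).
    by apply: ge0_subset_integral => //; exact: measurable_funTS.
  by rewrite EFinM -Em2.
have IwE : \int[cmeas mu]_(y in ball x r) (w y)%:E =
    (2 * A * L)%:E * \int[cmeas mu]_(y in ball x r) (powR (g y) q)%:E.
  rewrite -ge0_integralZl_EFin//; first exact: measurable_funTS.
have Iw : \int[cmeas mu]_(y in ball x r) (w y)%:E <= (A * m)%:E.
  rewrite IwE; apply: (le_trans (lee_wpmul2l _ IB)); first by rewrite lee_fin.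
  rewrite -EFinM lee_fin.
  have -> : (2 * A * L * (scale_frac * powR lam q * m2) =
     2 * A * (scale_frac * m2) * (powR lam q * L))%R by ring.
  rewrite lamL mulr1; have := ler_wpM2l A0 km; lra.
have w0 y : (0 <= w y)%R by rewrite mulr_ge0// powR_ge0.
have mw : measurable_fun (ball x r : set T) (EFin \o w : T -> _).
  apply: measurable_funTS; apply: (measurable_funeM (2 * A * L)%:E mgq).
have intw : (cmeas mu).-integrable (ball x r : set T) (EFin \o w : T -> _).
  apply/integrableP; split => //.
  under eq_integral do rewrite /= ger0_norm//.
  by rewrite (le_lt_trans Iw)// ltry.
have intk : (cmeas mu).-integrable (ball x r : set T) (EFin \o cst (M - A)%R : T -> _).
  apply: measurable_bounded_integrable => //.
    by change (mu (ball x r) < +oo); rewrite Em ltry.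
  exact: bounded_cst.
have [] := @integral_ae_lower (ball x r)
    ((EFin \o cst (M - A)%R) \- (EFin \o w)) u N mB _ mu_u N0 _.
- exact: integrableB.
- move=> y xy Ny; have := ptw y xy Ny; rewrite uE// /= -EFinB lee_fin.
  rewrite powRM ?invr_ge0 ?(ltW lam0)// -/L => h.
  rewrite /w; move: h; rewrite -[X in (_ <= X * _)%R -> _]mulrA -/A; lra.
move=> neg; rewrite integralB// => low; split => //.
rewrite /mavg Em inver gt_eqF// lee_pdivlMl//.
have Ik : \int[cmeas mu]_(y in ball x r) (EFin \o cst (M - A)%R) y = ((M - A) * m)%:E.
  by rewrite EFinM -Em; exact: (integral_cst (cmeas mu) mB (M - A)%:E).
apply: le_trans low; rewrite Ik.
apply: (@le_trans _ _ (((M - A) * m)%:E - (A * m)%:E)).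
  by rewrite -EFinB -EFinM lee_fin; lra.
by rewrite leeB.
Qed.

(** The set [E] may depend on [eta]: it is the exceptional set of
    quasicontinuity for a precision that improves as [eta] decreases. *)
Definition good_point (u : P -> \bar R) (g : P -> R) (x : P) :=
  forall eta : R, (0 < eta)%R -> exists (E : set P) (r1 : R),
    [/\ (0 < r1)%R, ~ E x, {within ~` E, continuous u} &
      forall r, (0 < r)%R -> (r < r1)%R ->
      mu (E `&` ball x r) < (2^-1)%:E * mu (ball x r) /\
      \int[cmeas mu]_(y in ball x r) (powR (g y) q)%:E <=
        (powR (eta * powR r (- s)) q)%:E * mu (ball x r)].

Lemma good_lower (u : P -> \bar R) (g : P -> R) (N : set P) (x : P) (M e : R) :
  mu_measurable mu u -> mu_measurable mu (EFin \o g) ->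
  hgrad mu s (fine \o u) g N -> (forall y, ~ N y -> u y = (fine (u y))%:E) ->
  good_point u g x -> M%:E < u x -> (0 < e)%R ->
  \forall r \near (0%R : R)^'+,
    \int[cmeas mu]_(y in ball x r) u^\- y < +oo /\
    (M - e)%:E <= mavg mu u (ball x r).
Proof.
move=> mu_u mg ug uE good Mu e0.
have q0 : (0 < q)%R by rewrite divr_gt0 ?addr_gt0.
have D0 := chain_const_ge0 q0; have k0 := scale_frac_gt0.
(* The summand 1 only makes the denominator positive. *)
pose e' : R := (e / (2 * chain_const q + 1))%R.
have D1 : (0 < 2 * chain_const q + 1)%R by rewrite ltr_wpDl ?mulr_ge0.
have e'0 : (0 < e')%R by rewrite divr_gt0.
pose eta := (powR scale_frac q^-1 * e')%R.
have eta0 : (0 < eta)%R by rewrite mulr_gt0// powR_gt0.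
have [E [r1 [r10 Ex cu small]]] := good eta eta0.
have [d /= d0 dM] : exists2 d : R, (0 < d)%R &
    forall z, ball x d z -> ~ E z -> M%:E <= u z.
  move/subspace_continuousP : cu => /(_ x Ex).
  move=> /(_ [set y | M%:E < y] (open_ereal_gt' Mu)).
  rewrite /= nbhs_filterE /= => /nbhs_ballP[d d0 dM].
  by exists d => // z xz Ez; apply/ltW/(dM z xz).
near=> r.
have r0 : (0 < r)%R by near: r; exact: nbhs_right_gt.
have rr1 : (r < r1 / 2)%R by near: r; apply: nbhs_right_lt; rewrite divr_gt0.
have rd : (r < d)%R by near: r; exact: nbhs_right_lt.
have r20 : (0 < 2 * r)%R by rewrite mulr_gt0.
have rs0 : (0 < powR r s)%R by rewrite powR_gt0.
pose lam := (e' * powR r (- s))%R.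
have lam0 : (0 < lam)%R by rewrite mulr_gt0// powR_gt0.
have rlam : (powR r s * lam = e')%R.
  by rewrite /lam powRN mulrCA mulfV ?gt_eqF// mulr1.
have [|dens _] := small r r0; first lra.
have [|_ Ig] := small (2 * r)%R r20; first lra.
have [|||neg low] := @mean_lower u g N E x r lam M mu_u mg ug uE r0 lam0.
- apply: (le_trans Ig); rewrite lee_wpmul2r ?outer_measure_ge0// lee_fin.
  have -> : (scale_frac * powR lam q = powR (powR scale_frac q^-1 * lam) q)%R.
    rewrite [RHS]powRM ?powR_ge0 ?(ltW lam0)// -powRrM mulVf ?gt_eqF//.
    by rewrite powRr1// ltW.
  apply: ge0_ler_powR; rewrite ?nnegrE ?(ltW q0)//.
  + by rewrite mulr_ge0 ?powR_ge0// ltW.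
  + by rewrite mulr_ge0 ?powR_ge0// ltW.
  rewrite /eta /lam -mulrA; apply: ler_wpM2l; first exact: powR_ge0.
  apply: ler_wpM2l; first exact: ltW.
  rewrite !powRN lef_pV2 ?posrE ?powR_gt0//.
  by apply: ge0_ler_powR; rewrite ?nnegrE ?(ltW s_gt0) ?(ltW r0) ?(ltW r20)//; lra.
- exact: dens.
- move=> z xz; apply: dM; move: xz; rewrite !ballEmdist /= => xz; lra.
split => //; apply: le_trans low; rewrite lee_fin rlam.
have e'E : (e' * (2 * chain_const q + 1) = e)%R by rewrite divfK ?gt_eqF.
lra.
Unshelve. all: by end_near. Qed.

Lemma cvg_ereal_between (I : Type) (F : set_system I) (f : I -> \bar R) (a : \bar R) :
  Filter F -> (forall M : R, M%:E < a -> \forall i \near F, M%:E < f i) ->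
  (forall M : R, a < M%:E -> \forall i \near F, f i < M%:E) -> f @ F --> a.
Proof.
move=> FF; case: a => [a| |] lo hi.
- move=> A [d /= d0 dA].
  have l1 : \forall i \near F, (a - d)%:E < f i.
    by apply: lo; rewrite lte_fin gtrBl.
  have l2 : \forall i \near F, f i < (a + d)%:E.
    by apply: hi; rewrite lte_fin ltrDl.
  apply: filterS2 l1 l2 => i /=; case: (f i) => [y| |] //=.
  rewrite !lte_fin => y1 y2; apply: dA => /=.
  by rewrite distrC ltr_distl; apply/andP; split; lra.
- by apply/cvgeyPgt => M; apply: lo; rewrite ltry.
- by apply/cvgeNyPlt => M; apply: hi; rewrite ltNyr.
Qed.

Lemma good_pointN (u : P -> \bar R) (g : P -> R) (x : P) :
  good_point u g x -> good_point (fun y => - u y) g x.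
Proof.
move=> good eta /good [E [r1 [r10 Ex cu H]]]; exists E, r1; split => //.
move/subspace_continuousP : cu => cu; apply/subspace_continuousP => y Ey.
by apply: cvgeN; exact: cu.
Qed.

(** Applying the lower bound to [- u] as well gives the upper bound. At least one
    of them is non-vacuous whatever the value of [u] at [x], and it makes one of
    the integrals of the positive and negative part finite. *)
Lemma good_lebesgue (u : P -> \bar R) (g : P -> R) (N : set P) (x : P) :
  mu_measurable mu u -> mu_measurable mu (EFin \o g) ->
  hgrad mu s (fine \o u) g N -> (forall y, ~ N y -> u y = (fine (u y))%:E) ->
  good_point u g x -> lebesgue_point mu u x.
Proof.
move=> mu_u mg ug uE good.
pose u' y := - u y.
have mu' : mu_measurable mu u' by exact: measurableT_comp.
have [N0 g0 ugN] := ug.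
have ug' : hgrad mu s (fine \o u') g N.
  split => // y z Ny Nz; have := ugN _ _ Ny Nz.
  by rewrite /u' /= (uE _ Ny) (uE _ Nz) /= -opprD normrN.
have uE' y : ~ N y -> u' y = (fine (u' y))%:E.
  by move=> Ny; rewrite /u' uE.
have lower := good_lower mu_u mg ug uE good.
have upper := good_lower mu' mg ug' uE' (good_pointN good).
have pos_neg (B : set P) : \int[cmeas mu]_(y in B) u'^\- y =
    \int[cmeas mu]_(y in B) u^\+ y by rewrite /u' funenegN.
have defd (M : R) : M%:E < u x \/ u x < M%:E -> \forall r \near (0%R : R)^'+,
    (\int[cmeas mu]_(y in ball x r) u^\+ y) +?
    (- \int[cmeas mu]_(y in ball x r) u^\- y).
  move=> [Mu|uM].
    near=> r; have [neg _] : \int[cmeas mu]_(y in ball x r) u^\- y < +oo /\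
      (M - 1)%:E <= mavg mu u (ball x r) by near: r; exact: lower.
    rewrite fin_num_adde_defl// fin_numN ge0_fin_numE//.
    by apply: integral_ge0 => y _; exact: funeneg_ge0.
  near=> r; have [pos _] : \int[cmeas mu]_(y in ball x r) u'^\- y < +oo /\
      (- M - 1)%:E <= mavg mu u' (ball x r).
    by near: r; apply: upper => //; rewrite EFinN lteN2.
  rewrite pos_neg in pos; rewrite fin_num_adde_defr// ge0_fin_numE//.
  by apply: integral_ge0 => y _; exact: funepos_ge0.
have defd' : \forall r \near (0%R : R)^'+,
    (\int[cmeas mu]_(y in ball x r) u^\+ y) +?
    (- \int[cmeas mu]_(y in ball x r) u^\- y).
  case E : (u x) => [a| |].
  - by apply: (defd (a - 1)%R); left; rewrite E lte_fin; lra.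
  - by apply: (defd 0%R); left; rewrite E ltry.
  - by apply: (defd 0%R); right; rewrite E ltNyr.
split => //; apply: cvg_ereal_between => M.
- move=> Mu; have [M' [MM' M'u]] : exists M' : R, (M < M')%R /\ M'%:E < u x.
    case: (u x) Mu => [a| |] //; last by exists (M + 1)%R; rewrite ltrDl ltry.
    rewrite lte_fin => Ma; exists ((M + a) / 2)%R; rewrite lte_fin.
    by split; lra.
  have d0 : (0 < (M' - M) / 2)%R by rewrite divr_gt0 ?subr_gt0.
  near=> r; have [_ low] : \int[cmeas mu]_(y in ball x r) u^\- y < +oo /\
      (M' - (M' - M) / 2)%:E <= mavg mu u (ball x r) by near: r; exact: lower.
  by apply: lt_le_trans low; rewrite lte_fin; lra.
- move=> uM; have [M' [MM' M'u]] : exists M' : R, (M' < M)%R /\ u x < M'%:E.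
    case: (u x) uM => [a| |] //; last by exists (M - 1)%R; rewrite gtrBl ltNyr.
    rewrite lte_fin => Ma; exists ((M + a) / 2)%R; rewrite lte_fin.
    by split; lra.
  have d0 : (0 < (M - M') / 2)%R by rewrite divr_gt0 ?subr_gt0.
  near=> r; have [_ low] : \int[cmeas mu]_(y in ball x r) u'^\- y < +oo /\
      (- M' - (M - M') / 2)%:E <= mavg mu u' (ball x r).
    by near: r; apply: upper => //; rewrite EFinN lteN2.
  have dr : (\int[cmeas mu]_(y in ball x r) u^\+ y) +?
    (- \int[cmeas mu]_(y in ball x r) u^\- y) by near: r.
  have avgN : mavg mu u' (ball x r) = - mavg mu u (ball x r).
    by rewrite /mavg /u' integralN// muleN.
  rewrite avgN leeNr in low; apply: (le_lt_trans low).
  by rewrite -EFinN lte_fin; lra.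
Unshelve. all: by end_near. Qed.

End means.

(** * Smallness of the exceptional set *)

Section assembly.
Context {R : realType} {P : pmetricType R}.
Variable mu : {outer_measure set P -> \bar R}.
Local Notation T := (caratheodory_type mu).
Variables (X : qbfs mu) (s : R).

Lemma hajlasz_norm_ge0 (v : P -> \bar R) : 0 <= hajlasz_norm X s v.
Proof.
have x0 f : 0 <= xnorm X f.
  rewrite /xnorm /extnorm; case: asboolP => // Xf.
  by rewrite lee_fin; exact: qnorm_ge0.
rewrite adde_ge0//; apply: le_ereal_inf_tmp => _ [g _ <-]; exact: x0.
Qed.

Lemma capacity_ge0 (E : set P) : 0 <= capacity X s E.
Proof. by apply: le_ereal_inf_tmp => _ [v _ <-]; exact: hajlasz_norm_ge0. Qed.

Lemma capacity_mono (E F : set P) : E `<=` F -> capacity X s E <= capacity X s F.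
Proof.
move=> EF; apply: le_ereal_inf_tmp => _ [v [Hv [U [oU FU v1]]] <-].
apply: ereal_inf_lbound; exists v => //; split => //; exists U; split => //; exact: subset_trans FU.
Qed.

Hypothesis X_abs : absolutely_continuous_norm X.

(** Absolute continuity along the superlevel sets of [g], which decrease to the
    empty set because [g] is finite everywhere. *)
Lemma small_superlevel (g : P -> R) (del : R) : inX X g -> (0 < del)%R ->
  exists2 m : R, (0 <= m)%R & exists f : P -> R,
    [/\ inX X f, (nX X f < del)%R & forall y, f y = if (m < g y)%R then g y else 0%R].
Proof.
move=> Xg del0.
pose E_ (n : nat) : set P := [set y | (n%:R < g y)%R].
have mE n : mu.-caratheodory (E_ n).
  have /measurable_EFinP mg := inX_measurable Xg.
  have := mg measurableT `]n%:R, +oo[%classic (measurable_itv _).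
  rewrite setTI; congr measurable.
  by apply/seteqP; split => x /=; rewrite in_itv /= andbT.
have dE n : E_ n.+1 `<=` E_ n.
  by move=> y; apply: lt_trans; rewrite ltr_nat.
have E0 : \bigcap_k E_ k = set0.
  apply/seteqP; split => // y Ey.
  have : (`|g y| < (Num.bound `|g y|)%:R)%R by exact: archi_boundP.
  have := Ey (Num.bound `|g y|) I; rewrite /E_ /= => h1 h2.
  by have := ler_norm (g y); rewrite leNgt (lt_trans h2 h1).
have := X_abs Xg mE dE E0.
move=> /(_ [set y | y < del%:E]) [].
  by apply: open_ereal_lt'; rewrite lte_fin.
move=> n _ /(_ n (leqnn _)) /= small.
exists n%:R => //.
pose f y : R := if (n%:R < g y)%R then g y else 0%R.
have fE : mulchi (EFin \o g) (E_ n) = EFin \o f.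
  apply/funext => y; rewrite /mulchi /f /= indicE.
  case: ifP => gy; first by rewrite mem_set// mule1.
  by rewrite memNset ?mule0//= /E_ /= gy.
rewrite fE in small; have [Xf _] := extnorm_le (ltW small).
exists f; split => //.
by move: small; rewrite xnormE// lte_fin.
Qed.

Hypothesis mu_regular : borel_regular mu.
Hypothesis mu_balls : balls_pos_finite mu.
Variable cd : R.
Hypothesis cd_gt0 : (0 < cd)%R.
Hypothesis mu_double : forall (x : P) (r : R), (0 < r)%R ->
  mu (ball x (2 * r)%R) <= cd%:E * mu (ball x r).
Variable q : R.
Hypotheses (s_gt0 : (0 < s)%R) (s_le1 : (s <= 1)%R) (q_gt0 : (0 < q)%R).
Hypothesis X_maximal : forall (x : P) (r : R), (0 < r)%R -> exists C : R,
  forall g : P -> \bar R, qcarrier X g -> (forall y, 0 <= g y) ->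
    xnorm X (mulchi
      (fun y => poweR (maximal mu 1 (fun z => poweR (g z) q) y) q^-1)
      (ball x r)) <= C%:E * xnorm X g.

(** The function [p] serves two purposes at once: it is a gradient of the test
    function of [E], and [t * p] dominates the part of [g] above [m]. *)
Lemma small_exception (u : P -> \bar R) (g : P -> R) (x0 : P) (r0 t del : R) :
  quasicontinuous X s u -> inX X g -> (forall y, (0 <= g y)%R) ->
  (0 < r0)%R -> (0 < t)%R -> (0 < del)%R ->
  exists (E U : set P) (p : P -> R) (m : R),
    [/\ E `<=` U, {within ~` E, continuous u},
      mu_measurable mu (EFin \o p) /\ (0 <= m)%R,
      forall y, (0 <= p y)%R /\ ((g y <= m)%R \/ (g y <= t * p y)%R) &
      capacity X s (U `|` [set z | exists r, ball x0 r0 z /\ bad_ball mu s q U p z r])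
        < del%:E].
Proof.
move=> qc Xg g0 r00 t0 del0.
have [C C0 HC] := capacity_bad mu_regular mu_balls cd_gt0 mu_double s_gt0 s_le1
  q_gt0 X_maximal x0 r00.
have [K K1 HK] := quasi_triangle X.
have K0 : (0 < 1 + 2 * K)%R by rewrite addr_gt0// mulr_gt0// (lt_le_trans ltr01).
have C1 : (0 < C + 1)%R by rewrite ltr_wpDl.
pose e : R := (del / ((C + 1) * (1 + 2 * K)))%R.
have e0 : (0 < e)%R by rewrite divr_gt0// mulr_gt0.
have [E [capE cu]] := qc e e0.
have [v [h [U [N [[Xv Xh nv nh] [oU EU vU v01 vh]]]]]] := capacity_test s_gt0 capE.
have [m m0 [f [Xf nf fE]]] := small_superlevel Xg (mulr_gt0 t0 e0).
have f0 y : (0 <= f y)%R by rewrite fE; case: ifP.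
have [Xtf ntf] := inXZ Xf (ltW (divr_gt0 ltr01 t0)).
have Xp := inXD Xh Xtf; have np := HK _ _ Xh Xtf.
have [N0 h0 vhN] := vh.
have tf0 y : (0 <= 1 / t * f y)%R by rewrite mulr_ge0// divr_ge0// ltW.
exists E, U, (fun y => h y + 1 / t * f y)%R, m; split => //.
- by split => //; exact: (inX_measurable Xp).
- move=> y; split; first by rewrite addr_ge0.
  have [mg|gm] := ltP m (g y); last by left.
  right; have -> : g y = f y by rewrite fE mg.
  have -> : (t * (h y + 1 / t * f y) = t * h y + f y)%R by field; rewrite gt_eqF.
  by rewrite lerDr mulr_ge0// ltW.
- have vp : hgrad mu s v (fun y => h y + 1 / t * f y)%R N.
    split => // [y|y z Ny Nz]; first by rewrite addr_ge0.
    apply: (le_trans (vhN _ _ Ny Nz)); apply: ler_wpM2l; first exact: powR_ge0.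
    by rewrite lerD// lerDl.
  apply: (le_lt_trans (HC v _ U N Xv Xp vp v01 oU vU)); rewrite lte_fin.
  rewrite ntf in np.
  have tfe : (1 / t * nX X f <= e)%R.
    by rewrite mulrC mulrA mulr1 ler_pdivrMr// mulrC ltW.
  have pe : (nX X (fun y => h y + 1 / t * f y) <= 2 * K * e)%R.
    have -> : (2 * K * e = K * (2 * e))%R by ring.
    by apply: (le_trans np); apply: ler_wpM2l; lra.
  apply: (@le_lt_trans _ _ (C * (e * (1 + 2 * K)))%R).
    by apply: ler_wpM2l => //; lra.
  have -> : (del = (C + 1) * (e * (1 + 2 * K)))%R.
    by rewrite /e; field; rewrite !gt_eqF.
  by rewrite ltr_pM2r; [rewrite ltrDl|exact: mulr_gt0].
Qed.

(** The level [m] is negligible against [r `^ (- s)] for small [r], while the part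
    of [g] above it is at most [t * p] and inherits the bound on the [q]-average
    of [p]; each of the two gets half of [eta `^ q]. *)
Lemma not_bad_good (g p : P -> R) (U : set P) (x : P) (t m eta r : R) :
  (forall y, (0 <= g y)%R) -> (forall y, (0 <= p y)%R) ->
  mu_measurable mu (EFin \o g) -> mu_measurable mu (EFin \o p) ->
  (forall y, (g y <= m)%R \/ (g y <= t * p y)%R) ->
  (0 < t)%R -> (0 <= m)%R -> (0 < r)%R -> (r < 2^-1)%R -> (0 < eta)%R ->
  (t <= eta * powR 2^-1 q^-1)%R ->
  (m <= eta * powR 2^-1 q^-1 * powR r (- s))%R ->
  ~ bad_ball mu s q U p x r ->
  mu (U `&` ball x r) < (2^-1)%:E * mu (ball x r) /\
  \int[cmeas mu]_(y in ball x r) (powR (g y) q)%:E <=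
    (powR (eta * powR r (- s)) q)%:E * mu (ball x r).
Proof.
move=> g0 p0 mg mp gmp t0 m0 r0 r12 eta0 teta meta nbad.
have [dens|dens] := ltP (mu (U `&` ball x r)) ((2^-1)%:E * mu (ball x r)); last first.
  by exfalso; apply: nbad; split => //; left.
split => //.
set I := \int[cmeas mu]_(y in ball x r) (powR (p y) q)%:E.
have [frac|frac] := ltP I ((powR (powR r (- s)) q)%:E * mu (ball x r)); last first.
  by exfalso; apply: nbad; split => //; right.
set H := (powR 2^-1 q^-1)%R in teta meta.
have HH : (powR H q = 2^-1)%R.
  by rewrite /H -powRrM mulVf ?gt_eqF// powRr1.
set a := powR r (- s) in meta frac *.
have a0 : (0 < a)%R by rewrite powR_gt0.
have H0 : (0 < H)%R by rewrite powR_gt0.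
have eH : (0 < eta * H)%R by rewrite mulr_gt0.
have half : (powR (eta * H * a) q = 2^-1 * powR (eta * a) q)%R.
  rewrite mulrAC [LHS]powRM ?(ltW H0)//; first by rewrite HH mulrC.
  by rewrite mulr_ge0 ?(ltW a0) ?(ltW eta0).
have mB : measurable (ball x r : set T) by exact: ball_caratheodory.
have mgq : mu_measurable mu (fun y => (powR (g y) q)%:E).
  exact: (measurableT_comp (measurable_poweR q) mg).
have mpq : mu_measurable mu (fun y => (powR (p y) q)%:E).
  exact: (measurableT_comp (measurable_poweR q) mp).
have [k k0 kE] : exists2 k, (0 <= k)%R & k = powR (eta * H * a) q.
  exact: (ex_intro2 _ _ (powR (eta * H * a) q) (powR_ge0 _ _) erefl).
have kk : (k + k = powR (eta * a) q)%R.
  have two : (2^-1 + 2^-1 = 1 :> R)%R by field.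
  by rewrite kE half -mulrDl two mul1r.
have [l l0 lE] : exists2 l, (0 <= l)%R & l = powR (eta * H) q.
  exact: (ex_intro2 _ _ (powR (eta * H) q) (powR_ge0 _ _) erefl).
have ptw y : (powR (g y) q <= k + l * powR (p y) q)%R.
  have lp0 : (0 <= l * powR (p y) q)%R by rewrite mulr_ge0 ?powR_ge0.
  case: (gmp y) => gy.
    apply: (ler_wpDr lp0); rewrite kE; apply: ge0_ler_powR; rewrite ?nnegrE ?(ltW q_gt0)//; last exact: le_trans meta.
    by rewrite mulr_ge0// ltW.
  apply: (ler_wpDl k0); rewrite lE -powRM ?(ltW eH)//.
  apply: ge0_ler_powR; rewrite ?nnegrE ?(ltW q_gt0) ?mulr_ge0 ?(ltW eta0) ?(ltW H0)//.
  by apply: (le_trans gy); apply: ler_wpM2r.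
apply: (@le_trans _ _ (\int[cmeas mu]_(y in ball x r)
    ((cst k%:E y) + (l%:E * (powR (p y) q)%:E)))).
  apply: ge0_le_integral => //.
  - by move=> y _; rewrite lee_fin powR_ge0.
  - exact: measurable_funTS.
  - apply: measurable_funTS; apply: emeasurable_funD; first exact: measurable_cst.
    exact: measurable_funeM.
  - by move=> y _; rewrite /= lee_fin.
have [M M0 EM] := ball_fin mu_balls x r0.
have mpB : measurable_fun (ball x r : set T) (fun y : T => (powR (p y) q)%:E).
  exact: measurable_funTS.
have pq0 y : 0 <= (powR (p y) q)%:E by rewrite lee_fin powR_ge0.
rewrite ge0_integralD//; last 2 first.
- by move=> y _; rewrite mule_ge0.
- exact: measurable_funeM.
rewrite ge0_integralZl_EFin// -/I.
have -> : \int[cmeas mu]_(y in ball x r) cst k%:E y = (k * M)%:E.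
  by rewrite EFinM -EM; exact: (integral_cst (cmeas mu) mB k%:E).
rewrite EM in frac *.
have lI : l%:E * I <= (l * (powR a q * M))%:E.
  by rewrite EFinM lee_wpmul2l ?lee_fin// EFinM ltW.
apply: (le_trans (leeD (lexx _) lI)); rewrite -EFinD -EFinM lee_fin.
have -> : (l * (powR a q * M) = k * M)%R.
  rewrite mulrA; congr (_ * _)%R; rewrite lE kE.
  exact: (esym (powRM q (ltW eH) (ltW a0))).
by rewrite -mulrDl kk.
Qed.

End assembly.

Theorem theorem1p2 (R : realType) (P : pmetricType R)
    (mu : {outer_measure set P -> \bar R})
    (mu_regular : borel_regular mu) (mu_balls : balls_pos_finite mu)
    (mu_doubling : doubling mu)
    (s : R) (s_gt0 : (0 < s)%R) (s_le1 : (s <= 1)%R)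
    (c Q : R) (c_gt0 : (0 < c)%R) (Q_gt0 : (0 < Q)%R)
    (mu_lower : forall (x y : P) (r rho : R),
      (0 < r)%R -> (r <= rho)%R -> ball x rho y ->
      (c * powR (r / rho) Q)%:E <= mu (ball y r) * (mu (ball x rho))^-1)
    (X : qbfs mu) (X_abs : absolutely_continuous_norm X)
    (X_maximal : let q := (Q / (Q + s))%R in
      forall (x : P) (r : R), (0 < r)%R -> exists C : R,
        forall g : P -> \bar R, qcarrier X g -> (forall y, 0 <= g y) ->
          xnorm X (mulchi
            (fun y => poweR (maximal mu 1 (fun z => poweR (g z) q) y) q^-1)
            (ball x r)) <= C%:E * xnorm X g)
    (u : P -> \bar R) (u_hom : hajlasz_hom X s u)
    (u_qc : quasicontinuous X s u) :
  quasieverywhere X s (lebesgue_point mu u).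
Proof.
have [cd cd0 mu_double] := mu_doubling.
have q0 : (0 < Q / (Q + s))%R by rewrite divr_gt0 ?addr_gt0.
have [[mu_u _] semi] := u_hom.
have [_ [g' gu <-] ng'] := ereal_inf_lt semi.
have Xg' : qcarrier X g'.
  by move: ng'; rewrite /xnorm /extnorm; case: asboolP.
have [g [N [Xg _ ug uE]]] := gradients_hgrad s_gt0 gu Xg'.
have [N0 g0 _] := ug.
have mg := inX_measurable Xg.
exists [set x | ~ lebesgue_point mu u x]; split; last by move=> x /contrapT.
apply/eqP; rewrite eq_le capacity_ge0 andbT.
apply/lee_addgt0Pr => e e0; rewrite add0e.
have [del del0 Hdel] := capacity_bigcup X s_gt0 e0.
have tk0 k : (0 < k.+1%:R^-1 :> R)%R by rewrite invr_gt0 ltr0Sn.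
have H k := small_exception X_abs mu_regular mu_balls cd0
  mu_double s_gt0 s_le1 q0 X_maximal (point : P) u_qc Xg g0 (ltr0Sn R k)
  (tk0 k) (del0 k).
have [E HE] := choice H; have [U HU] := choice HE.
have [p Hp] := choice HU; have [m Hm] := choice Hp.
pose F k := U k `|` [set z | exists r, ball (point : P) k.+1%:R z /\
  bad_ball mu s (Q / (Q + s)) (U k) (p k) z r].
apply: (@le_trans _ _ (capacity X s (\bigcup_k F k))); last first.
  by apply: Hdel => k; have [_ _ _ _] := Hm k.
apply: capacity_mono => x /= nleb; apply: contrapT => nF; apply: nleb.
apply: (good_lebesgue mu_regular mu_balls cd0 mu_double s_gt0 s_le1 c_gt0 Q_gt0
  mu_lower mu_u mg ug uE) => eta eta0.
set q := (Q / (Q + s))%R in q0 *.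
pose H2 : R := powR 2^-1 q^-1.
have eH : (0 < eta * H2)%R by rewrite mulr_gt0// powR_gt0.
(* The index [k] makes the ball around the base point large enough to contain
   [x] and the parameter [k.+1%:R^-1] small enough for [eta]. *)
pose k := Num.bound (mdist (point : P) x + (eta * H2)^-1).
have kx : (mdist (point : P) x + (eta * H2)^-1 < k.+1%:R)%R.
  apply: (@lt_trans _ _ k%:R); last by rewrite ltr_nat.
  by apply: archi_boundP; rewrite addr_ge0 ?mdist_ge0// invr_ge0 ltW.
have iH0 : (0 < (eta * H2)^-1)%R by rewrite invr_gt0.
have d0 := mdist_ge0 (point : P) x.
have [EU cu [mp m0] gmp _] := Hm k.
have xF : ~ F k x by move=> Fx; apply: nF; exists k.
have xU : ~ U k x by move=> Ux; apply: xF; left.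
have xbad r : ~ bad_ball mu s q (U k) (p k) x r.
  move=> bad; apply: xF; right; exists r; split => //.
  by rewrite ballEmdist /=; lra.
have m1 : (0 < m k + 1)%R by rewrite ltr_wpDl.
have r10 : (0 < powR (eta * H2 / (m k + 1)) s^-1)%R by rewrite powR_gt0// divr_gt0.
exists (E k), (Num.min 2^-1 (powR (eta * H2 / (m k + 1)) s^-1))%R; split => //.
- by rewrite lt_min r10 invr_gt0 ltr0n.
- by move=> /EU.
move=> r r0; rewrite lt_min => /andP[r12 rr1].
have tH : (k.+1%:R^-1 <= eta * H2)%R.
  by rewrite -[leRHS]invrK lef_pV2 ?posrE ?ltr0Sn//; lra.
have mr : (m k <= eta * H2 * powR r (- s))%R.
  rewrite powRN ler_pdivlMr ?powR_gt0//.
  have : (powR r s <= eta * H2 / (m k + 1))%R.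
    have -> : (eta * H2 / (m k + 1) = powR (powR (eta * H2 / (m k + 1)) s^-1) s)%R.
      by rewrite -powRrM mulVf ?gt_eqF// powRr1// divr_ge0 ?ltW.
    by apply: ge0_ler_powR; rewrite ?nnegrE ?(ltW s_gt0) ?(ltW r0) ?(ltW r10) ?(ltW rr1).
  rewrite ler_pdivlMr// mulrDr mulr1 mulrC.
  by have := powR_ge0 r s; lra.
have [dens Ig] := not_bad_good mu_regular mu_balls q0 g0 (fun y => (gmp y).1) mg mp
  (fun y => (gmp y).2) (tk0 k) m0 r0 r12 eta0 tH mr (@xbad r).
split => //; apply: le_lt_trans dens; apply: le_outer_measure.
by apply: setSI.
Qed.
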